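(* For any batch algorithm (in the setting below) using a constant number $B$ of batches whose lengths are fixed in advance (depending only on $T$), there exists $f$ with $\|f\|_k\le\Psi$ such that with probability at least $\frac12$: - for the SE kernel, $R_T=\Omega\Big(T^{\frac{1-\eta}{1-\eta^B}}(\log T)^{\frac{d(\eta-\eta^B)}{2(1-\eta^B)}}\Big)$ with $\eta=\frac12$; - for the Matérn kernel, $R_T=\Omega\Big(T^{\frac{1-\eta}{1-\eta^B}}\Big)$ with $\eta=\frac{\nu}{2\nu+d}$.
   Context: Setting: domain $\mathcal{X}=[0,1]^d$; $f$ lies in the RKHS of kernel $k$ with $\|f\|_k\le\Psi$, where $\Psi>0$ is a fixed constant. At each time $t=1,\dots,T$ a point $x_t$ is selected; time is split into $B$ consecutive batches of lengths $N_1,\dots,N_B$ summing to $T$; noisy observations $y_t=f(x_t)+\epsilon_t$ (i.i.d. $R$-sub-Gaussian noise) of a batch are revealed only at its end. Cumulative regret $R_T=\sum_{t=1}^T(f(x^\ast)-f(x_t))$ with $x^\ast\in\arg\max f$. Kernels: $k_{SE}(x,x')=\exp(-\|x-x'\|^2/(2l^2))$; $k_{\text{Matérn}}(x,x')=\frac{2^{1-\nu}}{\Gamma(\nu)}\big(\frac{\sqrt{2\nu}\|x-x'\|}{l}\big)^\nu B_\nu\big(\frac{\sqrt{2\nu}\|x-x'\|}{l}\big)$; $l,\nu,d$ fixed constants. Asymptotic notation is as $T\to\infty$ with $B$ fixed. *)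

(* Defs.v *)
From HB Require Import structures.
From mathcomp Require Import all_boot all_order all_algebra.
From mathcomp Require Import all_classical all_reals all_analysis.
Set Implicit Arguments. Unset Strict Implicit. Unset Printing Implicit Defensive.
Import Order.TTheory GRing.Theory Num.Theory.
Import numFieldNormedType.Exports.
Local Open Scope classical_set_scope.
Local Open Scope ring_scope.

Section Defs.
Variable R : realType.

Definition cube (d : nat) : set (d.-tuple R) :=
  [set x | forall i : 'I_d, 0 <= tnth x i <= 1].

Definition sqdist (d : nat) (x y : d.-tuple R) : R :=
  \sum_(i < d) (tnth x i - tnth y i) ^+ 2.

Definition k_SE (l : R) (d : nat) (x y : d.-tuple R) : R :=
  expR (- sqdist x y / (2 * l ^+ 2)).

Definition cosh_ (t : R) : R := (expR t + expR (- t)) / 2.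

Definition Gamma_ (nu : R) : R :=
  Rintegral lebesgue_measure `]0, +oo[ (fun t => t `^ (nu - 1) * expR (- t)).

Definition besselK (nu z : R) : R :=
  Rintegral lebesgue_measure `[0, +oo[
    (fun t => expR (- z * cosh_ t) * cosh_ (nu * t)).

(* Matern kernel; at distance 0 it takes its limiting value 1 *)
Definition k_Matern (l nu : R) (d : nat) (x y : d.-tuple R) : R :=
  let r := Num.sqrt (sqdist x y) in
  if r == 0 then 1 else
  let u := Num.sqrt (2 * nu) * r / l in
  2 `^ (1 - nu) / Gamma_ nu * u `^ nu * besselK nu u.

(* an element of the pre-Hilbert space H0 = span{k(., p)} is a finite
   list of (coefficient, point) pairs *)
Definition h0_eval (P : Type) (k : P -> P -> R) (g : seq (R * P)) (x : P) : R :=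
  \sum_(p <- g) p.1 * k p.2 x.

Definition h0_sqnorm (P : Type) (k : P -> P -> R) (g : seq (R * P)) : R :=
  \sum_(p <- g) \sum_(q <- g) p.1 * q.1 * k p.2 q.2.

Definition h0_sub (P : Type) (g h : seq (R * P)) : seq (R * P) :=
  g ++ [seq (- q.1, q.2) | q <- h].

(* f belongs to the RKHS H_k (on D) with ||f||_k <= Psi: f is the pointwise
   limit on D of an H0-Cauchy sequence whose H0 norms converge to a limit
   <= Psi  (the completion of H0, realised as functions on D). *)
Definition rkhs_ball (P : eqType) (k : P -> P -> R) (D : set P) (Psi : R)
    (f : P -> R) : Prop :=
  exists g : nat -> seq (R * P),
    [/\ forall n (p : R * P), p \in g n -> D p.2,
        forall e : R, 0 < e -> exists N : nat, forall m n : nat,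
          (N <= m)%N -> (N <= n)%N -> h0_sqnorm k (h0_sub (g m) (g n)) < e,
        forall x, D x -> (fun n => h0_eval k (g n) x) @ \oo --> f x
      & exists L : R, (fun n => h0_sqnorm k (g n)) @ \oo --> L /\ L <= Psi ^+ 2].

(* start of batch b (0-indexed times): N_0 + ... + N_{b-1} *)
Definition psum (B : nat) (N : 'I_B -> nat) (b : nat) : nat :=
  \sum_(j < B | (j < b)%N) N j.

(* the observation at time s is revealed before the point at time t is chosen
   iff some batch boundary lies in (s, t] *)
Definition visible (B : nat) (N : 'I_B -> nat) (s t : nat) : bool :=
  [exists b : 'I_B.+1, (s < psum N b)%N && (psum N b <= t)%N].

Definition masked (T B : nat) (N : 'I_B -> nat) (t : nat) (o : seq R)
    : T.-tuple R :=
  [tuple (if visible N i t then nth 0 o i else 0) | i < T].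

(* observations y_0 .. y_{n-1} produced by policy pi (with internal
   randomness z and noise values e) on objective f *)
Fixpoint observations (T B d : nat) (N : 'I_B -> nat)
    (pi : nat -> R * T.-tuple R -> d.-tuple R) (f : d.-tuple R -> R)
    (z : R) (e : nat -> R) (n : nat) : seq R :=
  match n with
  | 0 => [::]
  | n'.+1 =>
      let o := observations N pi f z e n' in
      rcons o (f (pi n' (z, masked T N n' o)) + e n')
  end.

Definition query (T B d : nat) (N : 'I_B -> nat)
    (pi : nat -> R * T.-tuple R -> d.-tuple R) (f : d.-tuple R -> R)
    (z : R) (e : nat -> R) (t : nat) : d.-tuple R :=
  pi t (z, masked T N t (observations N pi f z e t)).

(* cumulative regret R_T; f(x^* ) = max of f on [0,1]^d written as sup *)
Definition regret (T B d : nat) (N : 'I_B -> nat)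
    (pi : nat -> R * T.-tuple R -> d.-tuple R) (f : d.-tuple R -> R)
    (z : R) (e : nat -> R) : R :=
  \sum_(t < T) (sup [set f x | x in (@cube d)] - f (query N pi f z e t)).

Definition mutually_independent (dO : measure_display) (O : measurableType dO)
    (P : probability O R) (n : nat) (X : 'I_n -> O -> R) : Prop :=
  forall A : 'I_n -> set R, (forall i, measurable (A i)) ->
    P (\bigcap_(i in [set: 'I_n]) (X i @^-1` A i)) =
    (\prod_(i < n) P (X i @^-1` A i))%E.

Definition batch_lower_bound (d B : nat) (k : d.-tuple R -> d.-tuple R -> R)
    (Psi sig : R) (rate : nat -> R) : Prop :=
  exists c : R, 0 < c /\ exists T0 : nat, forall T : nat, (T0 <= T)%N ->
  forall (dO : measure_display) (O : measurableType dO) (P : probability O R)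
         (Z : O -> R) (eps : nat -> O -> R),
    measurable_fun setT Z ->
    (forall t, measurable_fun setT (eps t)) ->
    (forall t, (t < T)%N -> forall A, measurable A ->
        P (eps t @^-1` A) = normal_prob 0 sig A) ->
    mutually_independent P
      (fun i : 'I_T.+1 => if (i : nat) == 0%N then Z else eps (i.-1)) ->
  forall (N : 'I_B -> nat), (\sum_(b < B) N b)%N = T ->
  forall pi : nat -> R * T.-tuple R -> d.-tuple R,
    (forall t, measurable_fun setT (pi t)) ->
    (forall t zv, (@cube d) (pi t zv)) ->
  exists f : d.-tuple R -> R,
    rkhs_ball k ((@cube d)) Psi f /\
    ((1 / 2)%:E <= P [set w | (c * rate T <=
                            regret N pi f (Z w) (fun t => eps t w))%R])%E.

Definition eta_SE : R := 1 / 2.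
Definition eta_Matern (nu : R) (d : nat) : R := nu / (2 * nu + d%:R).

Definition rate_SE (d B : nat) (T : nat) : R :=
  let eta := eta_SE in
  T%:R `^ ((1 - eta) / (1 - eta ^+ B)) *
  ln T%:R `^ (d%:R * (eta - eta ^+ B) / (2 * (1 - eta ^+ B))).

Definition rate_Matern (nu : R) (d B : nat) (T : nat) : R :=
  let eta := eta_Matern nu d in
  T%:R `^ ((1 - eta) / (1 - eta ^+ B)).

End Defs.
Arguments cube {R} d.

(* Main.v *)
(* Let mu(T) be (ln T)^(d/2) for the squared exponential kernel and 1 for the
   Matérn kernel, and let X = T / mu. Compare the batch boundaries with the
   thresholds mu X^(e_j), where e_0 = 0, e_(j+1) = alpha + eta e_j and e_B = 1.
   Some batch j starts before mu X^(e_j) and is at least mu X^(e_(j+1)) / 2 long.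

   In each ball there are n^d bumps of height 2 h whose squares sum to O(h^2) at
   every point. If the number of observations available to batch j times
   h^2 / sig^2 is small compared with n^d, then for some bump f the observations
   have almost the law of pure noise, under which at least half of the queries of
   batch j miss f; so the regret is at least h N_j / 2 with probability 1/2. Taking
   h of order X^(- eta e_j) gives h N_j of order mu X^alpha, which is the rate.

   For the Matérn kernel, a bump is the part of its Gaussian scale mixture of
   width at most 1/n. For the squared exponential kernel, combinations of n
   translates are a Gaussian times a polynomial of degree < n in an exponential
   variable, and the bumps are products of Lagrange polynomials at Chebyshev
   nodes; their norms are at most e^(K n^2), so n of order sqrt(ln T) is allowed. *)
Require Import Defs.
From HB Require Import structures.
From mathcomp Require Import all_boot all_order all_algebra.
From mathcomp Require Import all_classical all_reals all_analysis.
From mathcomp Require Import measurable_realfun zify ring lra.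
Set Implicit Arguments. Unset Strict Implicit. Unset Printing Implicit Defensive.
Import Order.TTheory GRing.Theory Num.Theory.
Import numFieldNormedType.Exports.
Local Open Scope classical_set_scope.
Local Open Scope ring_scope.

(** * Change of measure along a history *)

(** The queries depend on noisy data, so the information collected along a run is random; the
    likelihood ratio is therefore carried step by step along the history. As the claim is a
    probability bound, this ratio must be bounded below on a large event; a second ratio, with a
    larger drift of opposite sign, gives that tail bound by Markov's inequality. Under pure noise
    the queries are the same for all bumps, so one pointwise bound on the sum of squares controls,
    by averaging over the bumps, both the number of queries that hit a bump and the information
    about it. The thresholds equalise the regret: a batch that starts before mu q is fooled by bumps
    of height h of order q^(- eta), and eta is the value for which the ball holds n^d of them with
    n^d of order mu q h^2. The functions in the space of the squared exponential kernel are
    analytic, so no bump there vanishes outside a cell; the sum of squares replaces disjointness of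
    supports. *)

Section Integration.
Context {R : realType}.
Local Open Scope ereal_scope.

Import HBNNSimple.

(** The density is given on sets; indicators, simple functions and monotone convergence carry it to
    nonnegative functions. *)
Lemma ge0_integral_density d (T : measurableType d)
    (mu nu : {measure set T -> \bar R}) (h : T -> R) (f : T -> \bar R) :
  measurable_fun setT h -> (forall x, 0 <= h x)%R ->
  (forall A, measurable A -> nu A = \int[mu]_(x in A) (h x)%:E) ->
  measurable_fun setT f -> (forall x, 0 <= f x) ->
  \int[nu]_x f x = \int[mu]_x (f x * (h x)%:E).
Proof.
move=> mh h0 nuE mf f0.
have indicE' E : measurable E ->
    \int[nu]_x (\1_E x)%:E = \int[mu]_x ((\1_E x)%:E * (h x)%:E).
  move=> mE; rewrite integral_indic//= setIT nuE// integral_mkcond.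
  apply: eq_integral => x _; rewrite patchE indicE.
  by case: ifPn; rewrite ?mul1e ?mul0e.
have nnE (g : {nnsfun T >-> R}) :
    \int[nu]_x (g x)%:E = \int[mu]_x ((g x)%:E * (h x)%:E).
  under [LHS]eq_integral do rewrite fimfunE -fsumEFin//.
  rewrite [LHS]ge0_integral_fsum//; last 2 first.
    - by move=> r; exact/measurable_EFinP/measurableT_comp.
    - by move=> n x _; rewrite EFinM nnfun_muleindic_ge0.
  under [RHS]eq_integral.
    move=> x xD; rewrite fimfunE -fsumEFin// ge0_mule_fsuml; last first.
      by move=> r; rewrite EFinM nnfun_muleindic_ge0.
    over.
  rewrite [RHS]ge0_integral_fsum//; last 2 first.
    - move=> r; apply: emeasurable_funM; last exact/measurable_EFinP.
      by apply/measurable_EFinP; do 2 apply/measurableT_comp => //.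
    - move=> n x _; rewrite mule_ge0 ?lee_fin ?h0//.
      by rewrite -lee_fin EFinM nnfun_muleindic_ge0.
  apply: eq_fsbigr => r _.
  rewrite integralZl_indic_nnsfun// indicE'//.
  under [RHS]eq_integral do rewrite EFinM -muleA.
  have [r0|r0] := leP 0%R r.
    rewrite ge0_integralZl//.
    - apply: emeasurable_funM; last exact/measurable_EFinP.
      exact/measurable_EFinP/measurable_indic.
    - by move=> x _; rewrite mule_ge0 ?lee_fin ?h0// indicE.
  rewrite preimage_nnfun0// integral0_eq; last first.
    by move=> x _; rewrite indic0 mul0e.
  rewrite mule0 integral0_eq// => x _.
  by rewrite indic0 mul0e mule0.
pose f_ := nnsfun_approx measurableT mf.
transitivity (lim (\int[nu]_x (f_ n x)%:E @[n --> \oo])).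
  rewrite -monotone_convergence//=.
  - apply: eq_integral => x _; apply/esym/cvg_lim => //=.
    exact: cvg_nnsfun_approx.
  - by move=> n; exact/measurable_EFinP/measurable_funP.
  - by move=> n ? _; rewrite lee_fin.
  - by move=> ? _ ? ? mn; rewrite lee_fin; exact/lefP/nd_nnsfun_approx.
rewrite (_ : (fun n => \int[nu]_x (f_ n x)%:E) =
    (fun n => \int[mu]_x ((f_ n x)%:E * (h x)%:E))); last first.
  by apply/funext => n; exact: nnE.
rewrite -monotone_convergence//=.
- apply: eq_integral => x _; apply/cvg_lim => //=.
  apply: cvgeZr => //; exact: cvg_nnsfun_approx.
- move=> n; apply: emeasurable_funM; last exact/measurable_EFinP.
  exact/measurable_EFinP/measurable_funP.
- by move=> n x _; rewrite mule_ge0 ?lee_fin ?h0.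
- move=> x _ m n mn; rewrite lee_wpmul2r ?lee_fin ?h0//.
  exact/lefP/nd_nnsfun_approx.
Qed.

Let mu := @lebesgue_measure R.

(** The image of Lebesgue measure under a shift agrees with it on intervals, hence everywhere. *)
Lemma ge0_integral_shift (a : R) (f : R -> \bar R) :
  measurable_fun setT f -> (forall x, 0 <= f x) ->
  \int[mu]_x f (a + x)%R = \int[mu]_x f x.
Proof.
move=> mf f0.
have ms : measurable_fun [set: measurableTypeR R] (fun x : measurableTypeR R => (a + x)%R : measurableTypeR R).
  exact: measurable_funD.
have E A : measurable A -> mu A = pushforward mu (fun x : measurableTypeR R => (a + x)%R : measurableTypeR R) A.
  move=> mA.
  apply: (@lebesgue_measure_unique R (pushforward mu (fun x : measurableTypeR R => (a + x)%R : measurableTypeR R))) => //.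
  move=> X [[x y]] _ <-/=; rewrite /pushforward.
  have -> : (fun z : R => (a + z)%R) @^-1` `]x, y]%classic = `](x - a)%R, (y - a)%R]%classic.
    by apply/seteqP; split => z /=; rewrite !in_itv/= ltrBlDl lerBrDl.
  rewrite !lebesgue_measure_itv/= !lte_fin ltrD2r; case: ifPn => // _.
  by rewrite -!EFinB; congr EFin; ring.
rewrite [RHS](_ : _ = \int[pushforward mu (fun x : measurableTypeR R => (a + x)%R : measurableTypeR R)]_x f x); last first.
  by apply: eq_measure_integral => A mA _; exact: E.
by rewrite ge0_integral_pushforward.
Qed.
End Integration.

Lemma mfun_exists d1 d2 (T1 : measurableType d1) (T2 : measurableType d2)
  (f : T1 -> T2) : measurable_fun setT f ->
  exists g : {mfun T1 >-> T2}, g = f :> (T1 -> T2).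
Proof. by move=> mf; exists (mfun_Sub (mem_set mf)); exact: mfun_valP. Qed.

(** * Independence of each noise variable from the past *)

Section Independence.
Context {R : realType} d (O : measurableType d) (P : probability O R).
Variables (sig : R) (T : nat) (Z : O -> R) (eps : nat -> O -> R).
Hypothesis mZ : measurable_fun setT Z.
Hypothesis meps : forall t, measurable_fun setT (eps t).
Hypothesis epsE : forall t, (t < T)%N -> forall A, measurable A ->
  P (eps t @^-1` A) = normal_prob 0 sig A.
Hypothesis indep : mutually_independent P
  (fun i : 'I_T.+1 => if (i : nat) == 0%N then Z else eps i.-1).

(** Padding with zeros to length [T] puts the histories of all times into one measurable type. *)
Definition prefix_tuple (n : nat) (y : nat -> R) : T.-tuple R :=
  [tuple if (i < n)%N then y i else 0 | i < T].

Definition update_tuple (n : nat) (v : T.-tuple R) (y : R) : T.-tuple R :=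
  [tuple if i == n :> nat then y else tnth v i | i < T].

Lemma prefix_tupleS n y :
  prefix_tuple n.+1 y = update_tuple n (prefix_tuple n y) (y n).
Proof.
apply: eq_from_tnth => i; rewrite !tnth_mktuple.
by rewrite ltnS leq_eqVlt; case: eqVneq => [->|].
Qed.

Lemma measurable_update_tuple n :
  measurable_fun setT (fun x : T.-tuple R * R => update_tuple n x.1 x.2).
Proof.
apply/measurable_fun_tnthP => i.
rewrite (_ : _ \o _ = fun x : T.-tuple R * R =>
    if i == n :> nat then x.2 else tnth x.1 i); last first.
  by apply/funext => x /=; rewrite tnth_mktuple.
case: eqP => _; first exact: measurable_snd.
exact: (measurableT_comp (measurable_tnth i)).
Qed.

Definition history n (w : O) : R * T.-tuple R :=
  (Z w, prefix_tuple n (fun t => eps t w)).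

Let X i w : R := if i == 0%N then Z w else eps i.-1 w.

Let mX i : measurable_fun setT (X i).
Proof. by rewrite /X; case: eqP. Qed.

(** Rectangles in [X 0], ..., [X n]: a pi-system whose sigma-algebra makes [history n]
    measurable. *)
Let G n : set (set O) := [set E | exists2 A : nat -> set R,
  (forall i, measurable (A i)) &
  E = [set w | forall i, (i <= n)%N -> A i (X i w)]].

Let GI n : setI_closed (G n).
Proof.
move=> _ _ [A mA ->] [B mB ->]; exists (fun i => A i `&` B i).
  by move=> i; exact: measurableI.
apply/seteqP; split => w /=.
  by move=> [a b] i ni; split; [exact: a|exact: b].
by move=> ab; split => i /ab[].
Qed.

Let Gm n : G n `<=` measurable.
Proof.
move=> _ [A mA ->].
rewrite (_ : [set _ | _] = \bigcap_(i in `I_n.+1) (X i @^-1` A i)).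
  apply: fin_bigcap_measurable => // i _.
  by rewrite -[X in measurable X]setTI; exact: mX.
by apply/seteqP; split.
Qed.

Let GT n : G n setT.
Proof. by exists (fun=> setT) => //; apply/seteqP; split. Qed.

Let GX n i (A : set R) : (i <= n)%N -> measurable A -> G n (X i @^-1` A).
Proof.
move=> ni mA; exists (fun j => if j == i then A else setT).
  by move=> j; case: eqP.
apply/seteqP; split => w /=; first by move=> Aw j _; case: eqP => [->|].
by move/(_ i ni); rewrite eqxx.
Qed.

Let P_G n (A : nat -> set R) : (n <= T)%N -> (forall i, measurable (A i)) ->
  P [set w | forall i, (i <= n)%N -> A i (X i w)] =
  (\prod_(i < T.+1 | (i <= n)%N) P (X i @^-1` A i))%E.
Proof.
move=> nT mA.
pose B (i : 'I_T.+1) := if (i <= n)%N then A i else setT.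
have mB i : measurable (B i) by rewrite /B; case: ifP.
have := indep mB.
rewrite (_ : \bigcap_(i in _) _ = [set w | forall i, (i <= n)%N -> A i (X i w)]).
  move=> ->; rewrite [RHS]big_mkcond/=; apply: eq_bigr => i _.
  rewrite /B; case: (boolP (i <= n)%N) => ni.
    by congr (P _); apply/seteqP; split => w /=; rewrite /X; case: eqP.
  by rewrite preimage_setT probability_setT.
apply/seteqP; split => w /=.
  move=> Bw i ni.
  have iT : (i < T.+1)%N by rewrite ltnS (leq_trans ni).
  have := Bw (Ordinal iT) Logic.I; rewrite /B/= ni /X.
  by case: eqP.
move=> Aw i _; rewrite /= /B; case: (boolP (i <= n)%N) => // ni; have := Aw i ni; rewrite /X.
by case: eqP.
Qed.

Let indepG n (B : set R) (E : set O) : (n < T)%N -> measurable B -> G n E ->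
  P (E `&` eps n @^-1` B) = (P (eps n @^-1` B) * P E)%E.
Proof.
move=> nT mB [A mA ->].
(* [eps n] is [X n.+1], so the intersection is again a rectangle, one index longer. *)
pose A' i := if i == n.+1 then B else A i.
have mA' i : measurable (A' i) by rewrite /A'; case: eqP.
transitivity (P [set w | forall i, (i <= n.+1)%N -> A' i (X i w)]).
  congr (P _); apply/seteqP; split => w /=.
    move=> [Aw Bw] i; rewrite leq_eqVlt /A'; case: eqP => [->//|_/=].
    exact: Aw.
  move=> Aw; split; last by have := Aw n.+1 (leqnn _); rewrite /A' eqxx.
  move=> i ni; have := Aw i (leqW ni); rewrite /A'; case: eqP => // i_.
  by move: ni; rewrite i_ ltnn.
rewrite !P_G//; last exact: ltnW.
rewrite (bigD1 (Ordinal (nT : n.+1 < T.+1)%N))//=; congr (_ * _)%E.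
  by congr (P _); rewrite /A' eqxx.
apply: eq_big => [i|i /andP[_ /negbTE]].
  rewrite -val_eqE/= [in LHS]leq_eqVlt ltnS.
  case: eqVneq => [->|]/=; last by rewrite andbT.
  by rewrite ltnn.
by rewrite -val_eqE/= /A' => ->.
Qed.

Lemma measurable_history n : measurable_fun setT (history n).
Proof.
apply: measurable_fun_pair => //; apply/measurable_fun_tnthP => i.
rewrite (_ : _ \o _ = fun w => if (i < n)%N then eps i w else 0); last first.
  by apply/funext => w /=; rewrite tnth_mktuple.
by case: (i < n)%N.
Qed.

Let history_G n (A : set (R * T.-tuple R)) : measurable A ->
  <<s G n >> (history n @^-1` A).
Proof.
move=> mA.
have mh : @measurable_fun _ _ (g_sigma_algebraType (G n)) _ setT (history n).
  have mXi i : (i <= n)%N ->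
      @measurable_fun _ _ (g_sigma_algebraType (G n)) _ setT (X i).
    move=> ni _ B mB; rewrite setTI; apply: sub_sigma_algebra.
    exact: GX.
  apply: measurable_fun_pair; first exact: (mXi 0%N).
  apply/measurable_fun_tnthP => i.
  rewrite (_ : _ \o _ = fun w => if (i < n)%N then X i.+1 w else 0); last first.
    by apply/funext => w /=; rewrite tnth_mktuple.
  by case: (boolP (i < n)%N) => // ni; exact: mXi.
by have := mh measurableT A mA; rewrite setTI.
Qed.

(** The restriction of [P] to the event on [eps n] and the multiple of [P] by its probability are
    finite measures that agree on the pi-system [G n], hence on all events of the history. *)
Lemma history_indep n (A : set (R * T.-tuple R)) (B : set R) : (n < T)%N ->
  measurable A -> measurable B ->
  P (history n @^-1` A `&` eps n @^-1` B) =
  (P (history n @^-1` A) * normal_prob 0 sig B)%E.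
Proof.
move=> nT mA mB.
have meB : measurable (eps n @^-1` B).
  by rewrite -[X in measurable X]setTI; exact: meps.
pose r : {nonneg R} := NngNum (fine_ge0 (measure_ge0 P (eps n @^-1` B))).
have rE : (r%:num%:E)%E = P (eps n @^-1` B).
  by rewrite /= fineK// fin_num_measure.
have : mrestr P meB (history n @^-1` A) = mscale r P (history n @^-1` A).
  apply: (@g_sigma_algebra_measure_unique _ R O (G n) _ (fun=> setT)) => //.
  - by apply/seteqP; split => // w _; exists 0%N.
  - move=> E GE; have := indepG nT mB GE; rewrite -rE; exact.
  - by move=> k; rewrite -ge0_fin_numE// fin_num_measure.
  - exact: history_G.
by rewrite /mrestr /mscale rE epsE// muleC.
Qed.

Local Open Scope ereal_scope.

(** Independence makes the joint law of the past and the next noise a product measure; Tonelli then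
    integrates the noise first. *)
Lemma integral_history n (F : (R * T.-tuple R) * measurableTypeR R -> \bar R) :
  (n < T)%N -> measurable_fun setT F -> (forall x, 0 <= F x) ->
  \int[P]_w F (history n w, eps n w) =
  \int[P]_w \int[normal_prob 0 sig]_y F (history n w, y).
Proof.
move=> nT mF F0.
have mh := measurable_history n.
have mhe : @measurable_fun _ _ O ((R * T.-tuple R) * measurableTypeR R)%type
    setT (fun w => (history n w, eps n w)).
  apply: measurable_fun_pair => //; exact: (meps n).
have [H HE] := mfun_exists mh.
have [H' H'E] := @mfun_exists _ _ O ((R * T.-tuple R) * measurableTypeR R)%type
  _ mhe.
transitivity (\int[distribution P H']_x F x).
  by rewrite ge0_integral_pushforward//= H'E.
transitivity (\int[distribution P H \x normal_prob 0 sig]_x F x).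
  apply: eq_measure_integral => A mA _; apply/esym.
  apply: product_measure_unique => // B C mB mC.
  transitivity (P (H' @^-1` (B `*` C))) => //; rewrite H'E history_indep//.
  by rewrite -HE.
rewrite (@fubini_tonelli1 _ _ (R * T.-tuple R)%type (measurableTypeR R) R _ _ F mF F0).
rewrite ge0_integral_pushforward; first by rewrite HE.
- exact: measurable_funPT.
- exact: measurableT.
- exact: measurable_fun_fubini_tonelli_F.
- by move=> x _; apply: integral_ge0.
Qed.

End Independence.

(** * Gaussian drifts and likelihood ratios *)

Section GaussianShift.
Context {R : realType}.
Variable sig : R.
Hypothesis sig0 : 0 < sig.

(** Density at [y] of the normal law with mean [g] with respect to the centred one of the same
    variance. *)
Definition shift_weight (g y : R) : R :=
  expR (g * y / sig ^+ 2 - g ^+ 2 / (2 * sig ^+ 2)).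

Lemma measurable_shift_weight d (T : measurableType d) (g y : T -> R) :
  measurable_fun setT g -> measurable_fun setT y ->
  measurable_fun setT (fun x => shift_weight (g x) (y x)).
Proof.
move=> mg my; apply: measurableT_comp => //; apply: measurable_funB.
  by apply: measurable_funM => //; exact: measurable_funM.
by apply: measurable_funM => //; exact: measurable_funX.
Qed.

Local Open Scope ereal_scope.

Lemma integral_normal_shift (g : R) (f : R -> \bar R) :
  measurable_fun setT f -> (forall x, 0 <= f x) ->
  \int[normal_prob 0 sig]_y f (g + y)%R =
  \int[normal_prob 0 sig]_y (f y * (shift_weight g y)%:E).
Proof.
move=> mf f0.
have density (h : R -> \bar R) :
    measurable_fun setT h -> (forall x, 0 <= h x) ->
    \int[normal_prob 0 sig]_y h y =
    \int[lebesgue_measure]_y (h y * (normal_pdf 0 sig y)%:E).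
  move=> mh h0.
  apply: (@ge0_integral_density R _ _ lebesgue_measure (normal_prob 0 sig)
    (normal_pdf 0 sig) h) => //.
    exact: measurable_normal_pdf.
  by move=> x; exact: normal_pdf_ge0.
rewrite (density (fun y => f (g + y)%R))//; last first.
  by apply: (measurableT_comp mf); exact: measurable_funD.
rewrite density//; last 2 first.
- apply: emeasurable_funM => //; apply/measurable_EFinP.
  exact: measurable_shift_weight.
- by move=> x; rewrite mule_ge0// lee_fin expR_ge0.
rewrite -[RHS](ge0_integral_shift g); last 2 first.
- apply: emeasurable_funM; last by apply/measurable_EFinP; exact: measurable_normal_pdf.
  apply: emeasurable_funM => //; apply/measurable_EFinP.
  exact: measurable_shift_weight.
- move=> x; rewrite !mule_ge0// lee_fin ?normal_pdf_ge0//.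
  by rewrite expR_ge0.
apply: eq_integral => y _; rewrite -muleA -EFinM; congr (_ * _%:E).
have s0 : sig != 0%R by rewrite gt_eqF.
rewrite !normal_pdfE// mulrCA /normal_fun -expRD; congr (_ * expR _)%R.
by field.
Qed.

End GaussianShift.

Section ChangeOfMeasure.
Context {R : realType} d (O : measurableType d) (P : probability O R).
Variables (sig : R) (T : nat) (Z : O -> R) (eps : nat -> O -> R).
Hypothesis sig0 : 0 < sig.
Hypothesis mZ : measurable_fun setT Z.
Hypothesis meps : forall t, measurable_fun setT (eps t).
Hypothesis epsE : forall t, (t < T)%N -> forall A, measurable A ->
  P (eps t @^-1` A) = normal_prob 0 sig A.
Hypothesis indep : mutually_independent P
  (fun i : 'I_T.+1 => if (i : nat) == 0%N then Z else eps i.-1).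

Let state := (R * T.-tuple R)%type.
Implicit Type s : state.

Variable g : nat -> state -> R.
Hypothesis mg : forall n, measurable_fun setT (g n).

(** A state has room for [T] observations; this erases those from time [n] on, which the drift at
    time [n] must not see. *)
Definition truncate n s : state := (s.1, prefix_tuple T n (nth 0 s.2)).

(** Turns a history of pure noise into observations: each noise is increased by a drift that depends
    on the past already drifted. *)
Fixpoint drifted n s : state :=
  if n is n'.+1 then
    let h := drifted n' s in
    (h.1, update_tuple n' h.2 (g n' h + nth 0 s.2 n'))
  else truncate 0 s.

(** Density of the law of the drifted history with respect to that of pure noise. *)
Definition likelihood n s : R :=
  \prod_(i < n) shift_weight sig (g i (truncate i s)) (nth 0 s.2 i).

Lemma nth_prefix_tuple n (y : nat -> R) i : (i < T)%N ->
  nth 0 (prefix_tuple T n y) i = if (i < n)%N then y i else 0.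
Proof.
by move=> iT; rewrite -[i]/(val (Ordinal iT)) -tnth_nth tnth_mktuple.
Qed.

Lemma measurable_nth_tuple i :
  measurable_fun setT (fun v : T.-tuple R => nth 0 v i).
Proof.
have [iT|Ti] := ltnP i T.
  rewrite (_ : (fun _ => _) = (@tnth _ _ ^~ (Ordinal iT))).
    exact: measurable_tnth.
  by apply/funext => v; rewrite (tnth_nth 0).
rewrite (_ : (fun _ => _) = cst 0)//.
by apply/funext => v; rewrite nth_default// size_tuple.
Qed.

Lemma measurable_truncate n : measurable_fun setT (truncate n).
Proof.
apply: measurable_fun_pair => //; apply/measurable_fun_tnthP => i.
rewrite (_ : _ \o _ = fun s => if (i < n)%N then nth 0 s.2 i else 0).
  by case: (i < n)%N => //; exact: measurableT_comp (measurable_nth_tuple i) _.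
by apply/funext => s /=; rewrite tnth_mktuple.
Qed.

Lemma measurable_drifted n : measurable_fun setT (drifted n).
Proof.
elim: n => [|n IHn] /=; first exact: measurable_truncate.
apply: measurable_fun_pair; first exact: measurableT_comp.
apply: (measurableT_comp (@measurable_update_tuple R T n) (g := fun s =>
  ((drifted n s).2, g n (drifted n s) + nth 0 s.2 n))).
apply: measurable_fun_pair; first exact: measurableT_comp.
apply: measurable_funD; first exact: measurableT_comp.
exact: measurableT_comp (measurable_nth_tuple n) _.
Qed.

Lemma measurable_likelihood n : measurable_fun setT (likelihood n).
Proof.
apply: measurable_prod => i _; apply: measurable_shift_weight.
  by apply: measurableT_comp => //; exact: measurable_truncate.
exact: measurableT_comp (measurable_nth_tuple i) _.
Qed.

Lemma likelihood_ge0 n s : 0 <= likelihood n s.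
Proof. by apply: prodr_ge0 => i _; exact: expR_ge0. Qed.

Local Notation history := (history T Z eps).

Lemma nth_history n w i : (i < n <= T)%N -> nth 0 (history n w).2 i = eps i w.
Proof.
move=> /andP[iltn nT].
rewrite -[(history n w).2]/(prefix_tuple T n (eps^~ w)).
by rewrite nth_prefix_tuple ?iltn// (leq_trans iltn).
Qed.

Lemma truncate_history m n w : (m <= n)%N -> (n <= T)%N ->
  truncate m (history n w) = history m w.
Proof.
move=> mn nT; congr (_, _); apply: eq_from_tnth => i; rewrite !tnth_mktuple.
by case: ltnP => // im; rewrite nth_history ?(leq_trans im).
Qed.

Lemma historyS n w :
  history n.+1 w = ((history n w).1, update_tuple n (history n w).2 (eps n w)).
Proof. by rewrite /history prefix_tupleS. Qed.

Lemma drifted_history m n w : (m <= n)%N -> (n <= T)%N ->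
  drifted m (history n w) = drifted m (history m w).
Proof.
elim: m n => [|m IHm] n mn nT /=.
  by rewrite !truncate_history.
rewrite !IHm//; try exact: ltnW.
- by rewrite !nth_history ?mn ?leqnn//= (leq_trans mn).
- by rewrite (leq_trans _ nT).
Qed.

Lemma likelihood_historyS n w : (n < T)%N ->
  likelihood n.+1 (history n.+1 w) =
  likelihood n (history n w) * shift_weight sig (g n (history n w)) (eps n w).
Proof.
move=> nT; rewrite /likelihood big_ord_recr/=; congr (_ * _).
  apply: eq_bigr => i _; rewrite !truncate_history//.
  - by rewrite !nth_history ?ltn_ord ?(ltnW nT)// ltnS ltnW.
  - exact: ltnW.
  - exact: ltnW.
  - by rewrite ltnW// ltnS ltnW.
by rewrite truncate_history// nth_history// leqnn.
Qed.

Local Open Scope ereal_scope.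

(** Induction on [n]: the last noise is integrated out, the Gaussian shift turns its drift into a
    weight, and the induction hypothesis applies to the resulting function [psi] of the shorter
    history. *)
Lemma change_of_measure n (phi : state -> \bar R) : (n <= T)%N ->
  measurable_fun setT phi -> (forall s, 0 <= phi s) ->
  \int[P]_w phi (drifted n (history n w)) =
  \int[P]_w (phi (history n w) * (likelihood n (history n w))%:E).
Proof.
elim: n phi => [|n IHn] phi nT mphi phi0.
  apply: eq_integral => w _; rewrite /likelihood big_ord0 mule1/=.
  by rewrite truncate_history.
pose upd (x : state * R) : state := (x.1.1, update_tuple n x.1.2 x.2).
have mupd : measurable_fun setT upd.
  apply: measurable_fun_pair; first exact: measurableT_comp.
  apply: (measurableT_comp (@measurable_update_tuple R T n)
    (g := fun x : state * R => (x.1.2, x.2))).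
  by apply: measurable_fun_pair => //; exact: measurableT_comp.
pose wt (x : state * R) := (shift_weight sig (g n x.1) x.2)%:E.
have mwt : measurable_fun setT wt.
  apply/measurable_EFinP; apply: measurable_shift_weight => //.
  exact: measurableT_comp.
have wt0 x : 0 <= wt x by rewrite lee_fin expR_ge0.
pose G (x : state * R) := phi (upd x) * wt x.
have mG : measurable_fun setT G.
  by apply: emeasurable_funM => //; exact: measurableT_comp.
have G0 x : 0 <= G x by rewrite mule_ge0.
pose psi s := \int[normal_prob 0 sig]_y G (s, y).
have mpsi : measurable_fun setT psi.
  exact: (@measurable_fun_fubini_tonelli_F _ _ _ (measurableTypeR R) _ (normal_prob 0 sig) G).
have psi0 s : 0 <= psi s by exact: integral_ge0.
have msec (h : state * R -> \bar R) s : measurable_fun setT h ->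
    measurable_fun setT (fun y => h (s, y)).
  by move=> mh; apply: measurableT_comp => //; exact: measurable_fun_pair.
transitivity (\int[P]_w psi (drifted n (history n w))).
  pose F (x : state * R) :=
    phi (upd (drifted n x.1, g n (drifted n x.1) + x.2)%R).
  have mF : measurable_fun setT F.
    have mD : measurable_fun setT (fun x : state * R => drifted n x.1).
      by apply: measurableT_comp => //; exact: measurable_drifted.
    apply: (measurableT_comp mphi); apply: (measurableT_comp mupd
      (g := fun x : state * R => (drifted n x.1, g n (drifted n x.1) + x.2)%R)).
    apply: measurable_fun_pair => //; apply: measurable_funD => //.
    exact: measurableT_comp.
  transitivity (\int[P]_w F (history n w, eps n w)).
    apply: eq_integral => w _; rewrite /F /upd/=.
    rewrite drifted_history// ?(ltnW nT)//.
    by rewrite nth_history// leqnn.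
  rewrite (integral_history mZ meps epsE indep nT mF (fun x => phi0 (upd _))).
  apply: eq_integral => w _; rewrite /F/=.
  rewrite (integral_normal_shift sig0 _
    (f := fun y => phi (upd (drifted n (history n w), y))))//.
  by apply: (msec (fun x => phi (upd x))); exact: measurableT_comp.
rewrite IHn//; last exact: ltnW.
pose F (x : state * R) := G x * (likelihood n x.1)%:E.
transitivity (\int[P]_w F (history n w, eps n w)); last first.
  apply: eq_integral => w _; rewrite /F /G /wt /upd/=.
  rewrite -muleA -EFinM likelihood_historyS// historyS.
  by rewrite [in RHS]mulrC.
have mF : measurable_fun setT F.
  apply: emeasurable_funM => //; apply/measurable_EFinP.
  by apply: measurableT_comp => //; exact: measurable_likelihood.
rewrite (integral_history mZ meps epsE indep nT mF); last first.
  by move=> x; rewrite mule_ge0// lee_fin likelihood_ge0.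
apply: eq_integral => w _; rewrite /psi /F/= ge0_integralZr//.
- exact: msec.
- by rewrite lee_fin likelihood_ge0.
Qed.

End ChangeOfMeasure.

(** * From likelihood ratios to probabilities *)

(** If every event had probability above [K], their sum would exceed the integral of the pointwise
    bound. *)
Lemma exists_unlikely_event {R : realType} d (O : measurableType d)
    (P : probability O R) (I : finType) (E : I -> set O) (K : R) :
  (0 < #|I|)%N -> (forall m, measurable (E m)) ->
  (forall w, \sum_(m : I) \1_(E m) w <= K * #|I|%:R) ->
  exists m, (P (E m) <= K%:E)%E.
Proof.
move=> I0 mE EK; apply/not_existsP => PE.
have : (\sum_(m : I) P (E m) <= (K * #|I|%:R)%:E)%E.
  rewrite (_ : (\sum_(m : I) P (E m) =
      \int[P]_w (\sum_(m : I) \1_(E m) w)%:E)%E); last first.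
    under eq_integral do rewrite -sumEFin.
    rewrite ge0_integral_sum//.
    - by apply: eq_bigr => m _; rewrite integral_indic// setIT.
    - by move=> m; exact/measurable_EFinP/measurable_indic.
  apply: (@le_trans _ _ (\int[P]_w (cst (K * #|I|%:R)%:E w))%E).
    apply: ge0_le_integral => //=.
    - by move=> w _; rewrite lee_fin; apply: sumr_ge0 => m _; rewrite indicE.
    - apply/measurable_EFinP; apply: measurable_sum => m.
      exact: measurable_indic.
    - by move=> w _; rewrite lee_fin.
  by rewrite integral_cst//= probability_setT mule1.
apply/negP; rewrite -ltNge.
rewrite (_ : (K * #|I|%:R)%:E = \sum_(m : I) K%:E)%E; last first.
  by rewrite sumEFin sumr_const mulr_natr.
have PK m : (K%:E < P (E m))%E by rewrite ltNge; apply/negP; exact: PE.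
have PfE m : P (E m) = (fine (P (E m)))%:E by rewrite fineK// fin_num_measure.
under [ltRHS]eq_bigr do rewrite PfE.
rewrite !sumEFin lte_fin.
apply: ltr_sum => [|m _]; last by rewrite -lte_fin -PfE.
by have /card_gt0P[m _] := I0; apply/hasP; exists m => //; rewrite mem_index_enum.
Qed.

Section Energy.
Context {R : realType}.
Variables (sig : R) (T : nat).
Let state := (R * T.-tuple R)%type.
Implicit Type s : state.

Variable g : nat -> state -> R.
Hypothesis mg : forall n, measurable_fun setT (g n).

(** The quadratic term of the log-likelihood: the squared drifts in units of the noise variance. *)
Definition energy n s : R :=
  \sum_(i < n) (g i (truncate i s)) ^+ 2 / sig ^+ 2.

Lemma measurable_energy n : measurable_fun setT (energy n).
Proof.
apply: measurable_sum => i; apply: measurable_funM => //.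
apply: measurable_funX; apply: measurableT_comp => //.
exact: measurable_truncate.
Qed.

Lemma likelihoodE n s : likelihood sig g n s =
  expR (\sum_(i < n) g i (truncate i s) * nth 0 s.2 i / sig ^+ 2
        - energy n s / 2).
Proof.
rewrite /likelihood /shift_weight -expR_sum; congr expR.
rewrite sumrB; congr (_ - _); rewrite /energy mulr_suml.
by apply: eq_bigr => i _; rewrite invfM; ring.
Qed.

End Energy.

(* With the drift multiplied by -32 the likelihood still has mean 1, and its
   logarithm is -32 times the original one minus 528 = (32^2 + 32) / 2 times the
   energy, so it is at least e^7 wherever the original one is small and the
   energy is. *)
Lemma small_likelihood_amplified {R : realType} (sig : R) T
    (g : nat -> R * T.-tuple R -> R) n s : energy sig g n s <= 528^-1 ->
  likelihood sig g n s < expR (- 4^-1) ->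
  8 <= likelihood sig (fun i s => - 32 * g i s) n s.
Proof.
rewrite !likelihoodE ltr_expR /energy; cbv beta; set S := \sum_(i < n) _ ^+ 2 / _.
move=> s0; set X := \sum_(i < n) _ => LX.
have -> : \sum_(i < n) - 32 * g i (truncate i s) * s.2`_i / sig ^+ 2 = - 32 * X.
  by rewrite mulr_sumr; apply: eq_bigr => i _; ring.
have -> : \sum_(i < n) (- 32 * g i (truncate i s)) ^+ 2 / sig ^+ 2 =
    1024 * S.
  by rewrite mulr_sumr; apply: eq_bigr => i _; ring.
apply: (@le_trans _ _ (expR 7)).
  by have := expR_ge1Dx (7 : R); apply: le_trans; lra.
by rewrite ler_expR; move: s0 LX; lra.
Qed.

Section LikelihoodRatio.
Context {R : realType} d (O : measurableType d) (P : probability O R).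
Variables (sig : R) (T : nat) (Z : O -> R) (eps : nat -> O -> R).
Hypothesis sig0 : 0 < sig.
Hypothesis mZ : measurable_fun setT Z.
Hypothesis meps : forall t, measurable_fun setT (eps t).
Hypothesis epsE : forall t, (t < T)%N -> forall A, measurable A ->
  P (eps t @^-1` A) = normal_prob 0 sig A.
Hypothesis indep : mutually_independent P
  (fun i : 'I_T.+1 => if (i : nat) == 0%N then Z else eps i.-1).

Let state := (R * T.-tuple R)%type.
Implicit Type s : state.

Variable g : nat -> state -> R.
Hypothesis mg : forall n, measurable_fun setT (g n).

Local Notation history := (history T Z eps).

(** Within [A] there is an event of pure-noise probability at least 3/4 on which the likelihood is
    at least e^(- 1/4) >= 3/4; and 9/16 exceeds 1/2. *)
Lemma drifted_probability_ge n (A : set state) : (n <= T)%N -> measurable A ->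
  (P [set w | ~ A (history n w) \/ (528^-1 < energy sig g n (history n w))%R] <=
    (8^-1)%:E)%E ->
  ((1 / 2)%:E <= P [set w | A (drifted g n (history n w))])%E.
Proof.
move=> nT mA PA.
have mh := measurable_history (T := T) mZ meps n.
have preim (B : set state) : measurable B -> measurable (history n @^-1` B).
  by move=> mB; rewrite -[X in measurable X]setTI; exact: mh.
have mLg : measurable_fun setT (likelihood sig g n).
  exact: measurable_likelihood.
pose g' i s := - 32 * g i s.
have mg' i : measurable_fun setT (g' i) by exact: measurable_funM.
have mLg' : measurable_fun setT (likelihood sig g' n).
  exact: measurable_likelihood.
have le_meas (f h : state -> R) : measurable_fun setT f ->
    measurable_fun setT h -> measurable [set s | f s <= h s].
  by move=> mf mh'; rewrite -[X in measurable X]setTI; exact: measurable_fun_le.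
pose G := [set s | expR (- 4^-1) <= likelihood sig g n s].
have mG : measurable G by exact: le_meas.
pose D := [set s | 8 <= likelihood sig g' n s].
have mD : measurable D by exact: le_meas.
pose S := [set s | energy sig g n s <= 528^-1].
have mS : measurable S by apply: le_meas => //; exact: measurable_energy.
have bad : [set w | ~ A (history n w) \/ 528^-1 < energy sig g n (history n w)] =
    history n @^-1` (~` (A `&` S)).
  apply/seteqP; split => w /=.
    by move=> [nA [//]|eS [_]]; rewrite /S/= leNgt eS.
  move=> nAS; have [Aw|nA] := pselect (A (history n w)); last by left.
  by right; rewrite ltNge; apply/negP => Sw; exact: nAS.
have mAS := measurableI _ _ mA mS.
(* Markov's inequality: the likelihood of the amplified drift [g'] has mean 1, by the change of
   measure applied to the constant 1. *)
have PD : (P (history n @^-1` D) <= (8^-1)%:E)%E.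
  have : ((8%:E * P (history n @^-1` D)) <= 1)%E.
    have := @change_of_measure _ _ _ P sig T Z eps sig0 mZ meps epsE indep g'
      mg' n (cst 1%E) nT (measurable_cst _) (fun _ => lee01).
    rewrite integral_cst//= probability_setT mule1 => ->.
    rewrite -[X in P X]setIT -integral_indic//; last exact: preim.
    rewrite -ge0_integralZl//; last first.
      by apply/measurable_EFinP; exact: measurable_indic (preim _ mD).
    apply: ge0_le_integral => //=.
    - apply/measurable_EFinP; apply: measurable_funM => //.
      exact: measurable_indic (preim _ mD).
    - apply: emeasurable_funM => //; apply/measurable_EFinP.
      exact: measurableT_comp.
    - move=> w _; rewrite mul1e -EFinM lee_fin indicE.
      case: (boolP (w \in _)); last by rewrite mulr0 likelihood_ge0.
      by rewrite inE mulr1.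
  rewrite -(fineK (fin_num_measure P _ (preim _ mD))) -EFinM !lee_fin.
  lra.
have PGA : ((3 / 4)%:E <= P (history n @^-1` (A `&` G)))%E.
  have : (P (~` (history n @^-1` (A `&` G))) <= (4^-1)%:E)%E.
    apply: (@le_trans _ _ (P (history n @^-1` (~` (A `&` S)) `|`
        history n @^-1` D))).
      apply: le_measure; rewrite ?inE.
      - by apply: measurableC; apply: preim; exact: measurableI.
      - by apply: measurableU; apply: preim => //; exact: measurableC.
      move=> w /= nAG; have [[Aw Sw]|nAS] := pselect ((A `&` S) (history n w)).
        right; apply: small_likelihood_amplified => //.
        by rewrite ltNge; apply/negP => Gw; exact: nAG.
      by left.
    apply: (le_trans (measureU2 _ _ _)); try exact: preim.
      by apply: preim; exact: measurableC.
    rewrite (_ : 4^-1 = 8^-1 + 8^-1 :> R); last by field.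
    by rewrite EFinD leeD// -bad.
  have mAG : measurable (history n @^-1` (A `&` G)).
    by apply: preim; exact: measurableI.
  rewrite probability_setC// -(fineK (fin_num_measure P _ mAG)).
  rewrite -EFinB !lee_fin; lra.
(* Back to the drifted law, whose probability of [A] is the pure-noise integral of the likelihood
   over [A]. *)
have := @change_of_measure _ _ _ P sig T Z eps sig0 mZ meps epsE indep g mg n
  (fun s => (\1_A s)%:E) nT.
rewrite (_ : (\int[P]_w (\1_A (drifted g n (history n w)))%:E =
    P [set w | A (drifted g n (history n w))])%E); last first.
  rewrite -[X in _ = P X]setIT -integral_indic//; last first.
    rewrite (_ : [set w | _] = (drifted g n \o history n) @^-1` A)//.
    rewrite -[X in measurable X]setTI.
    by apply: (measurableT_comp (measurable_drifted mg n) mh).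
move=> ->; last 2 first.
- by apply/measurable_EFinP; exact: measurable_indic.
- by move=> s; rewrite lee_fin.
apply: (@le_trans _ _ ((3 / 4)%:E * P (history n @^-1` (A `&` G)))%E).
  apply: (@le_trans _ _ ((3 / 4)%:E * (3 / 4)%:E)%E).
    by rewrite -EFinM lee_fin; lra.
  by rewrite lee_wpmul2l// lee_fin; lra.
have mAG : measurable (history n @^-1` (A `&` G)).
  by apply: preim; exact: measurableI.
rewrite -[X in P X]setIT -integral_indic// -ge0_integralZl//; last first.
  exact/measurable_EFinP/measurable_indic.
apply: ge0_le_integral => //=.
- by apply/measurable_EFinP; apply: measurable_funM => //; exact: measurable_indic.
- apply: emeasurable_funM; apply/measurable_EFinP.
    by apply: measurableT_comp => //; exact: measurable_indic.
  exact: measurableT_comp.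
- move=> w _; rewrite -!EFinM lee_fin !indicE.
  case: (boolP (w \in _)) => [|_]; last first.
    by rewrite mulr0 mulr_ge0// likelihood_ge0.
  rewrite inE => -[Aw Gw]; rewrite mem_set//= mulr1 mul1r.
  apply: le_trans Gw; have := expR_ge1Dx (- 4^-1 : R); lra.
Qed.

End LikelihoodRatio.

(** * Regret within one batch *)

Section BatchedAlgorithm.
Context {R : realType}.
Variables (T B D : nat) (N : 'I_B -> nat).
Hypothesis sumN : (\sum_(b < B) N b)%N = T.
Variable pi : nat -> R * T.-tuple R -> D.-tuple R.
Hypothesis mpi : forall t, measurable_fun setT (pi t).
Hypothesis pi_cube : forall t zv, (@cube R D) (pi t zv).

Let state := (R * T.-tuple R)%type.
Implicit Types (s : state) (f : D.-tuple R -> R) (z : R) (e : nat -> R).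

Lemma leq_psum b c : (b <= c)%N -> (psum N b <= psum N c)%N.
Proof.
move=> bc; rewrite /psum [leqLHS]big_mkcond [leqRHS]big_mkcond/=.
apply: leq_sum => j _; case: ifPn => // jb.
by rewrite (leq_trans jb bc).
Qed.

Lemma psumS (j : 'I_B) : psum N j.+1 = (psum N j + N j)%N.
Proof.
rewrite /psum (bigD1 j)//= addnC; congr addn; apply: eq_bigl => i.
by rewrite ltnS [in RHS]ltn_neqAle andbC.
Qed.

Lemma psum_leT b : (psum N b <= T)%N.
Proof.
rewrite -sumN /psum big_mkcond/=; apply: leq_sum => j _.
by case: ifP.
Qed.

Lemma visible_ltn i t : visible N i t -> (i < t)%N.
Proof. by move=> /existsP[b /andP[ib bt]]; exact: leq_trans bt. Qed.

(** Inside batch [j] the last boundary passed is its own start, so nothing later is visible. *)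
Lemma visible_batch (j : 'I_B) i t : (t < psum N j.+1)%N ->
  visible N i t -> (i < psum N j)%N.
Proof.
move=> tj /existsP[b /andP[ib bt]]; apply: (leq_trans ib).
apply: leq_psum; rewrite leqNgt; apply/negP => jb.
by have := leq_ltn_trans (leq_trans (leq_psum jb) bt) tj; rewrite ltnn.
Qed.

(** The query as a function of a state, so that the same policy can be fed pure noise or actual
    observations. *)
Definition policy_query t s : D.-tuple R := pi t (s.1, masked T N t s.2).

Lemma measurable_policy_query t : measurable_fun setT (policy_query t).
Proof.
apply: measurableT_comp => //; apply: measurable_fun_pair => //.
apply/measurable_fun_tnthP => i.
rewrite (_ : _ \o _ = fun s => if visible N i t then nth 0 s.2 i else 0).
  case: (visible N i t) => //.
  exact: measurableT_comp (measurable_nth_tuple i) _.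
by apply/funext => s /=; rewrite tnth_mktuple.
Qed.

Lemma masked_ext m t (o o' : seq R) :
  (forall i, visible N i t -> (i < m)%N) ->
  (forall i, (i < T)%N -> (i < m)%N -> nth 0 o i = nth 0 o' i) ->
  masked T N t o = masked T N t o'.
Proof.
move=> vm oo'; apply: eq_from_tnth => i; rewrite !tnth_mktuple.
by case: ifP => // /vm im; rewrite oo'.
Qed.

Lemma size_observations f z e n : size (observations N pi f z e n) = n.
Proof. by elim: n => //= n IHn; rewrite size_rcons IHn. Qed.

Lemma nth_observations f z e m n i : (i < m <= n)%N ->
  nth 0 (observations N pi f z e n) i = nth 0 (observations N pi f z e m) i.
Proof.
move=> /andP[im]; elim: n => [|n IHn] mn.
  by move: mn im; rewrite leqn0 => /eqP ->.
move: mn; rewrite leq_eqVlt ltnS => /predU1P[->//|mn].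
by rewrite /= nth_rcons size_observations (leq_trans im mn) IHn.
Qed.

Definition observed f z e n : state :=
  (z, prefix_tuple T n (nth 0 (observations N pi f z e n))).

(** Links the abstract drift to the algorithm: running it on [f] adds to each noise the value of [f]
    at the query. *)
Lemma drifted_observed d (O : measurableType d) (Z : O -> R)
    (eps : nat -> O -> R) f n w : (n <= T)%N ->
  drifted (fun t s => f (policy_query t s)) n (history T Z eps n w) =
  observed f (Z w) (eps^~ w) n.
Proof.
elim: n => [|n IHn] nT.
  by congr (_, _); apply: eq_from_tnth => i; rewrite !tnth_mktuple.
rewrite [LHS]/= drifted_history// IHn ?(ltnW nT)//.
rewrite [in LHS]/observed /=; congr (_, _).
rewrite prefix_tupleS; congr update_tuple.
  apply: eq_from_tnth => i; rewrite !tnth_mktuple.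
  by case: ifP => // iltn; rewrite nth_rcons size_observations iltn.
rewrite nth_rcons size_observations ltnn eqxx -/(history T Z eps n.+1 w).
rewrite (@nth_history _ _ _ T Z eps n.+1 w n) ?leqnn//; congr (f _ + _).
congr (pi _ (_, _)); apply: (@masked_ext n) => [i|i iT iltn].
  exact: visible_ltn.
by rewrite nth_prefix_tuple// iltn.
Qed.

(** This is where batching enters: the whole batch is a function of the observations made before its
    start. *)
Lemma query_batch (j : 'I_B) f z e t : (psum N j <= t < psum N j.+1)%N ->
  query N pi f z e t = policy_query t (observed f z e (psum N j)).
Proof.
move=> /andP[jt tj]; congr (pi _ (_, _)).
apply: (@masked_ext (psum N j)) => [i|i iT ij]; first exact: visible_batch.
by rewrite nth_prefix_tuple// ij; apply: nth_observations; rewrite ij.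
Qed.

Definition in_batch (j : 'I_B) t := (psum N j <= t < psum N j.+1)%N.

Lemma card_batch (j : 'I_B) : (\sum_(t < T | in_batch j t) 1)%N = N j.
Proof.
transitivity (\sum_(psum N j <= t < psum N j.+1) 1)%N; last first.
  by rewrite sum_nat_const_nat psumS addKn muln1.
rewrite (big_nat_widen _ _ T) ?psum_leT// big_geq_mkord.
by apply: eq_bigl => t; rewrite /in_batch andbC.
Qed.

Definition hits (j : 'I_B) f (h : R) s : R :=
  \sum_(t < T | in_batch j t) (h < f (policy_query t s))%R%:R.

Lemma measurable_hits j f h : measurable_fun setT f ->
  measurable_fun setT (hits j f h).
Proof.
move=> mf; rewrite /hits; under eq_fun do rewrite big_mkcond.
apply: measurable_sum => t; case: (in_batch j t) => //=.
apply: (measurableT_comp (f := fun b : bool => b%:R : R)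
  (g := fun s => h < f (policy_query t s))) => //.
apply: measurable_fun_ltr => //; apply: measurableT_comp => //.
exact: measurable_policy_query.
Qed.

Lemma le_sup_cube f K x : (forall x, (@cube R D) x -> f x <= K) ->
  (@cube R D) x -> f x <= sup [set f x | x in (@cube R D)].
Proof.
move=> fK Dx; apply: ub_le_sup; last by exists x.
by exists K => _ [y Dy <-]; exact: fK.
Qed.

(** Each query of the batch with f at most [h] loses at least 2 h - h, and all other queries have
    nonnegative regret; the bound [K] makes the supremum finite. *)
Lemma regret_ge (j : 'I_B) f h K z e c : 0 <= h ->
  (forall x, (@cube R D) x -> f x <= K) -> (@cube R D) c -> 2 * h <= f c ->
  hits j f h (observed f z e (psum N j)) <= (N j)%:R / 2 ->
  h * (N j)%:R / 2 <= regret N pi f z e.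
Proof.
move=> h0 fK Dc hc hitsN.
have supE x : (@cube R D) x -> 0 <= sup [set f x | x in (@cube R D)] - f x.
  by move=> Dx; rewrite subr_ge0; exact: le_sup_cube fK Dx.
rewrite /regret (bigID (fun t : 'I_T => in_batch j t))/=.
apply: (@le_trans _ _ (\sum_(t < T | in_batch j t)
    (h - h * (h < f (policy_query t (observed f z e (psum N j))))%R%:R))).
  have -> : \sum_(t < T | in_batch j t) (h - h *
      (h < f (policy_query t (observed f z e (psum N j))))%R%:R) =
      h * ((N j)%:R - hits j f h (observed f z e (psum N j))).
    rewrite mulrBr -(card_batch j) natr_sum !mulr_sumr -sumrB.
    by apply: eq_bigr => t _; rewrite mulr1.
  by rewrite -mulrA ler_wpM2l//; move: hitsN; lra.
rewrite -[leLHS]addr0; apply: lerD; last first.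
  by apply: sumr_ge0 => t _; apply: supE; exact: pi_cube.
apply: ler_sum => t tj; rewrite (query_batch _ _ _ tj).
set x := policy_query _ _; have Dx : (@cube R D) x by exact: pi_cube.
have [hx|xh] := ltP h (f x); first by rewrite mulr1 subrr; exact: supE.
rewrite mulr0 subr0; have := le_sup_cube fK Dc; lra.
Qed.

Lemma measurable_query f d (O : measurableType d) (Z : O -> R)
    (eps : nat -> O -> R) t :
  measurable_fun setT f -> measurable_fun setT Z ->
  (forall t, measurable_fun setT (eps t)) -> (t < T)%N ->
  measurable_fun setT (fun w => query N pi f (Z w) (eps^~ w) t).
Proof.
move=> mf mZ meps tT.
rewrite (_ : (fun _ => _) = fun w => policy_query t
    (drifted (fun t s => f (policy_query t s)) t (history T Z eps t w))).
  apply: measurableT_comp; first exact: measurable_policy_query.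
  apply: measurableT_comp; last exact: measurable_history.
  apply: measurable_drifted => n; apply: measurableT_comp => //.
  exact: measurable_policy_query.
apply/funext => w; rewrite drifted_observed; last exact: ltnW.
congr (pi _ (_, _)); apply: (@masked_ext t) => [i|i iT it].
  exact: visible_ltn.
by rewrite nth_prefix_tuple// it.
Qed.

Lemma measurable_regret f d (O : measurableType d) (Z : O -> R)
    (eps : nat -> O -> R) :
  measurable_fun setT f -> measurable_fun setT Z ->
  (forall t, measurable_fun setT (eps t)) ->
  measurable_fun setT (fun w => regret N pi f (Z w) (eps^~ w)).
Proof.
move=> mf mZ meps; apply: measurable_sum => t; apply: measurable_funB => //.
by apply: measurableT_comp => //; exact: measurable_query.
Qed.

(** Averaging over the bumps under pure noise. At each query at most C bumps exceed [h], and the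
    squared drifts sum to at most C h^2 / sig^2. So few bumps are hit often or reveal much, and some
    bump avoids both with probability at least 7/8, which is what the change of measure requires. *)
Lemma exists_hard_instance (sig : R) (j : 'I_B) (I : finType)
    (f : I -> D.-tuple R -> R) (h C : R) d (O : measurableType d)
    (P : probability O R) (Z : O -> R) (eps : nat -> O -> R) :
  0 < sig -> measurable_fun setT Z ->
  (forall t, measurable_fun setT (eps t)) ->
  (forall t, (t < T)%N -> forall A, measurable A ->
    P (eps t @^-1` A) = normal_prob 0 sig A) ->
  mutually_independent P
    (fun i : 'I_T.+1 => if (i : nat) == 0%N then Z else eps i.-1) ->
  (0 < #|I|)%N -> 0 < h -> (forall m, measurable_fun setT (f m)) ->
  (forall m, exists2 c, (@cube R D) c & 2 * h <= f m c) ->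
  (forall x, (@cube R D) x -> \sum_m f m x ^+ 2 <= C * h ^+ 2) ->
  8 * (2 * C + 528 * C * (psum N j)%:R * h ^+ 2 / sig ^+ 2) <= #|I|%:R ->
  exists m, ((1 / 2)%:E <=
    P [set w | (h * (N j)%:R / 2 <= regret N pi (f m) (Z w) (eps^~ w))%R])%E.
Proof.
move=> sig0 mZ meps epsE indep I0 h0 mf fc fC MC.
pose g m t s := f m (policy_query t s).
have mg m t : measurable_fun setT (g m t).
  by apply: measurableT_comp => //; exact: measurable_policy_query.
pose n := psum N j; have nT : (n <= T)%N by exact: psum_leT.
pose A m := [set s | hits j (f m) h s <= (N j)%:R / 2].
have mA m : measurable (A m).
  rewrite -[X in measurable X]setTI; apply: measurable_fun_le => //.
  exact: measurable_hits.
pose bad m := [set s : state | ~ A m s \/ 528^-1 < energy sig (g m) n s].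
have mbad m : measurable (bad m).
  rewrite (_ : bad m = ~` A m `|` ~` [set s | energy sig (g m) n s <= 528^-1]).
    apply: measurableU; apply: measurableC => //.
    rewrite -[X in measurable X]setTI; apply: measurable_fun_le => //.
    exact: measurable_energy.
  by apply/seteqP; split => s /= []; [left|rewrite ltNge => /negP; right|left
    |move/negP; rewrite -ltNge; right].
have badM s : \sum_m \1_(bad m) s <= 8^-1 * #|I|%:R :> R.
  (* Markov's inequality for each of the two ways to be bad. In an empty batch the quotient is 0,
     but then [A m] holds. *)
  apply: (@le_trans _ _ (\sum_m (2 * hits j (f m) h s / (N j)%:R
                                 + 528 * energy sig (g m) n s))).
    apply: ler_sum => m _.
    have hits0 : 0 <= 2 * hits j (f m) h s / (N j)%:R.
      by rewrite divr_ge0// mulr_ge0// sumr_ge0.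
    have en0 : 0 <= 528 * energy sig (g m) n s.
      apply: mulr_ge0; first exact: ler0n.
      by apply: sumr_ge0 => i _; rewrite divr_ge0 ?sqr_ge0.
    rewrite indicE; case: (boolP (s \in _)) => [|_]; last exact: addr_ge0.
    rewrite inE mulr1n => -[/negP|en]; last first.
      by move: hits0 en; lra.
    rewrite -ltNge => hN.
    have Nj : 0 < (N j)%:R :> R.
      rewrite ltr0n lt0n; apply/eqP => N0; move: hN; rewrite N0 mul0r.
      have := card_batch j; rewrite N0 => /eqP; rewrite sum_nat_eq0.
      move=> /forall_inP noj; rewrite ltNge; apply/negP; rewrite negbK.
      by rewrite /hits big1// => t /noj.
    rewrite -[leLHS]addr0; apply: lerD => //.
    by rewrite ler_pdivlMr// mul1r; move: hN; lra.
  rewrite big_split/= -mulr_suml -mulr_sumr -mulr_sumr.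
  have hitsC : \sum_m hits j (f m) h s <= C * (N j)%:R.
    rewrite exchange_big/= -(card_batch j) natr_sum mulr_sumr.
    apply: ler_sum => t _; rewrite mulr1.
    have h2 : 0 < h ^+ 2 by rewrite exprn_gt0.
    rewrite -(ler_pM2r h2) mulr_suml.
    apply: le_trans (fC (policy_query t s) (pi_cube _ _)).
    apply: ler_sum => m _; case: ltP => hf; last by rewrite mul0r sqr_ge0.
    by rewrite mul1r !expr2 ler_pM// ltW.
  have enC : \sum_m energy sig (g m) n s <= C * n%:R * h ^+ 2 / sig ^+ 2.
    rewrite exchange_big/=.
    have -> : C * n%:R * h ^+ 2 / sig ^+ 2 =
        \sum_(i < n) C * h ^+ 2 / sig ^+ 2.
      by rewrite sumr_const card_ord -mulr_natr; ring.
    apply: ler_sum => i _; rewrite -mulr_suml ler_wpM2r//.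
      by rewrite invr_ge0 sqr_ge0.
    exact: fC (pi_cube _ _).
  have C0 : 0 <= C.
    have := fC (pi 0%N (0, prefix_tuple T 0 (cst 0))) (pi_cube _ _).
    move=> /(le_trans (sumr_ge0 _ (fun _ _ => sqr_ge0 _))).
    by rewrite pmulr_lge0// exprn_gt0.
  have hitsC' : 2 * (\sum_m hits j (f m) h s) / (N j)%:R <= 2 * C.
    have [->|Nj] := eqVneq (N j) 0%N; first by rewrite invr0 mulr0 mulr_ge0.
    rewrite ler_pdivrMr ?ltr0n ?lt0n//; move: hitsC; lra.
  move: MC hitsC' enC; rewrite -/n.
  rewrite (_ : 528 * C * _ * _ / _ = 528 * (C * n%:R * h ^+ 2 / sig ^+ 2)).
    set u := _ / sig ^+ 2; set v := _ / (N j)%:R; set E := \sum_m energy _ _ _ _.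
    lra.
  by ring.
have mh := measurable_history (T := T) mZ meps n.
have [m Pm] := @exists_unlikely_event R _ O P I
    (fun m => history T Z eps n @^-1` bad m) 8^-1 I0
    (fun m => ltac:(rewrite -[X in measurable X]setTI; exact: mh))
    (fun w => badM (history T Z eps n w)).
exists m.
have [c Dc hc] := fc m.
(* The inequality y <= y^2 + 1 turns the bound on squares into the upper bound that makes the
   supremum finite. *)
have fK x : (@cube R D) x -> f m x <= C * h ^+ 2 + 1.
  move=> Dx; apply: (@le_trans _ _ (f m x ^+ 2 + 1)).
    have := sqr_ge0 (f m x - 2^-1); rewrite sqrrB; lra.
  rewrite lerD2r; apply: le_trans (fC x Dx).
  by rewrite (bigD1 m)//= lerDl sumr_ge0// => i _; rewrite sqr_ge0.
apply: le_trans (drifted_probability_ge sig0 mZ meps epsE indep (mg m) nT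
  (mA m) Pm) _.
apply: le_measure; rewrite ?inE.
- rewrite (_ : [set w | _] = (drifted (g m) n \o history T Z eps n) @^-1` A m)//.
  rewrite -[X in measurable X]setTI.
  by apply: (measurableT_comp (measurable_drifted (mg m) n) mh).
- rewrite -[X in measurable X]setTI; apply: measurable_fun_le => //.
  exact: measurable_regret.
move=> w /=; rewrite drifted_observed// => hw.
exact: (regret_ge (ltW h0) fK Dc hc hw).
Qed.

End BatchedAlgorithm.

(** * Balls of a reproducing kernel Hilbert space *)

Lemma cvgr_sqr_dist {R : realType} (a : nat -> R) (l K : R) :
  (forall n, (a n - l) ^+ 2 <= K / n.+1%:R) -> a @ \oo --> l.
Proof.
move=> aK; apply/cvgrPdist_le => e e0.
have Ke : 0 < e ^+ 2 / (`|K| + 1) by rewrite divr_gt0 ?exprn_gt0// ltr_wpDl.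
have [n0 _ n0P] := near_infty_natSinv_lt (PosNum Ke).
exists n0 => // n /= n0n; rewrite distrC.
rewrite -(@ler_pXn2r _ 2)// ?nnegrE ?normr_ge0 ?(ltW e0)//.
rewrite real_normK ?num_real//; apply: (le_trans (aK n)).
have := n0P n n0n; rewrite /= ltr_pdivlMr ?ltr_wpDl// => hn.
apply/ltW/(le_lt_trans _ hn); rewrite mulrC ler_wpM2l ?invr_ge0//.
by rewrite (le_trans (ler_norm K)) ?lerDl.
Qed.

Section RieszRepresentation.
Context {R : realType} (P : eqType) (k : P -> P -> R) (D : set P).

Definition supported (g : seq (R * P)) : Prop := forall p, p \in g -> D p.2.

Definition h0_dot (g h : seq (R * P)) : R :=
  \sum_(p <- g) \sum_(q <- h) p.1 * q.1 * k p.2 q.2.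

Definition h0_scale (c : R) (g : seq (R * P)) : seq (R * P) :=
  [seq (c * p.1, p.2) | p <- g].

(** The inner product of [f] with an element of the span, as the reproducing property dictates
    it. *)
Definition h0_pair (f : P -> R) (g : seq (R * P)) : R :=
  \sum_(p <- g) p.1 * f p.2.

Lemma supported_cat g h : supported g -> supported h -> supported (g ++ h).
Proof. by move=> Dg Dh p; rewrite mem_cat => /orP[/Dg|/Dh]. Qed.

Lemma supported_scale c g : supported g -> supported (h0_scale c g).
Proof. by move=> Dg _ /mapP[p /Dg Dp ->]. Qed.

Lemma h0_dot_catl g g' h : h0_dot (g ++ g') h = h0_dot g h + h0_dot g' h.
Proof. by rewrite /h0_dot big_cat. Qed.

Lemma h0_dot_catr g h h' : h0_dot g (h ++ h') = h0_dot g h + h0_dot g h'.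
Proof. by rewrite -big_split; apply: eq_bigr => p _; rewrite big_cat. Qed.

Lemma h0_dot_scalel c g h : h0_dot (h0_scale c g) h = c * h0_dot g h.
Proof.
rewrite /h0_dot big_map mulr_sumr; apply: eq_bigr => p _.
by rewrite mulr_sumr; apply: eq_bigr => q _ /=; rewrite !mulrA.
Qed.

Lemma h0_dot_scaler c g h : h0_dot g (h0_scale c h) = c * h0_dot g h.
Proof.
rewrite /h0_dot mulr_sumr; apply: eq_bigr => p _.
by rewrite big_map mulr_sumr; apply: eq_bigr => q _ /=; ring.
Qed.

Lemma h0_pair_cat f g h : h0_pair f (g ++ h) = h0_pair f g + h0_pair f h.
Proof. by rewrite /h0_pair big_cat. Qed.

Lemma h0_pair_scale f c g : h0_pair f (h0_scale c g) = c * h0_pair f g.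
Proof.
by rewrite /h0_pair big_map mulr_sumr; apply: eq_bigr => p _; rewrite mulrA.
Qed.

Lemma h0_subE g h : h0_sub g h = g ++ h0_scale (-1) h.
Proof.
by congr cat; apply: eq_map => p; rewrite mulN1r.
Qed.

Lemma h0_dot_eval g x : h0_dot g [:: (1, x)] = h0_eval k g x.
Proof. by apply: eq_bigr => p _; rewrite big_seq1/= mulr1. Qed.

Hypothesis k_sym : forall x y, k x y = k y x.

Lemma h0_dotC g h : h0_dot g h = h0_dot h g.
Proof.
rewrite /h0_dot exchange_big/=; apply: eq_bigr => p _; apply: eq_bigr => q _.
by rewrite k_sym (mulrC p.1).
Qed.

Hypothesis k_psd : forall g, supported g -> 0 <= h0_sqnorm k g.

(* g minimises J = |g|^2 - 2 <g, f>; by the parallelogram law a minimising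
   sequence is Cauchy, and stationarity of J in the direction k(x, .) says
   that its limit takes the value f x at x. *)
Lemma rkhs_ball_dual (f : P -> R) (Psi : R) :
  (forall g, supported g -> h0_pair f g ^+ 2 <= Psi ^+ 2 * h0_sqnorm k g) ->
  rkhs_ball k D Psi f.
Proof.
move=> fPsi.
pose Q g := h0_dot g g; pose F := h0_pair f; pose J g := Q g - 2 * F g.
have Q0 g : supported g -> 0 <= Q g by exact: k_psd.
have FQ g : supported g -> F g ^+ 2 <= Psi ^+ 2 * Q g by exact: fPsi.
pose S := [set J g | g in supported].
have FQ2 g : supported g -> 2 * F g <= Q g / 2 + 2 * Psi ^+ 2.
  move=> Dg; have := FQ g Dg; have := Q0 g Dg; have := sqr_ge0 Psi.
  set p := Psi ^+ 2; set q := Q g; set x := F g => p0 q0 xpq.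
  rewrite leNgt; apply/negP => H.
  have : (q / 2 + 2 * p) ^+ 2 < (2 * x) ^+ 2 by rewrite ltr_pXn2r// nnegrE; lra.
  by have := sqr_ge0 (q / 2 - 2 * p); rewrite !expr2 in xpq *; lra.
have Jlb g : supported g -> - (2 * Psi ^+ 2) <= J g.
  by move=> Dg; have := FQ2 g Dg; have := Q0 g Dg; rewrite /J; lra.
have S0 : S !=set0 by exists (J [::]); exists [::].
have Slb : has_lbound S by exists (- (2 * Psi ^+ 2)) => _ [g Dg <-]; exact: Jlb.
have Sinf : has_inf S by [].
have [i0 i0E] : exists i, i = inf S by eexists.
have i0_le g : supported g -> i0 <= J g by move=> Dg; rewrite i0E; apply: ge_inf => //; exists g.
have i0_le0 : i0 <= 0.
  have := i0_le [::] (fun p => ltac:(by rewrite in_nil)).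
  by rewrite /J /Q /F /h0_dot /h0_pair !big_nil mulr0 subr0.
have ex n : exists g, supported g /\ J g < i0 + n.+1%:R^-1.
  have [_ [g Dg <-] Jg] := inf_adherent (ltac:(by rewrite invr_gt0) : 0 < n.+1%:R^-1 :> R) Sinf.
  by exists g; rewrite i0E.
have [g /all_and2[Dg Jg]] := choice ex.
have parallelogram m n : h0_sqnorm k (h0_sub (g m) (g n)) <=
    2 * m.+1%:R^-1 + 2 * n.+1%:R^-1.
  have := i0_le _ (supported_scale (c := 2^-1) (supported_cat (Dg m) (Dg n))).
  rewrite -[h0_sqnorm k _]/(h0_dot _ _) h0_subE /J /Q /F h0_pair_scale h0_pair_cat.
  rewrite !(h0_dot_scalel, h0_dot_scaler, h0_dot_catl, h0_dot_catr).
  rewrite (h0_dotC (g n) (g m)).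
  have := Jg m; have := Jg n; rewrite /J /Q /F.
  move: (h0_dot _ _) (h0_dot _ _) (h0_dot _ _) (h0_pair _ _) (h0_pair _ _)
    m.+1%:R^-1 n.+1%:R^-1 => a b c x y u v.
  clear -i0. lra.
have Qbd n : Q (g n) <= 2 + 4 * Psi ^+ 2.
  have n1 : n.+1%:R^-1 <= 1 :> R by rewrite invf_le1// ler1n.
  move: (FQ2 _ (Dg n)) (Jg n) i0_le0 n1; rewrite {1}/J.
  move: n.+1%:R^-1 (F _) (Q _) (Psi ^+ 2) => u x q p; clear; lra.
(* Near-minimality bounds the linear coefficient of a perturbation. The choice t = - b / (a + 1)
   also covers a = 0. *)
have quad (a b e : R) : 0 <= a -> (forall t, - e <= 2 * t * b + t ^+ 2 * a) ->
    b ^+ 2 <= (a + 1) * e.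
  move=> a0 /(_ (- b / (a + 1))).
  have a1 : 0 < a + 1 by rewrite ltr_wpDl.
  rewrite -(ler_pM2r a1); set c := (X in _ <= X) => H.
  have cE : c = - 2 * b ^+ 2 + b ^+ 2 * (a / (a + 1)).
    by rewrite /c; field; rewrite gt_eqF.
  have : a / (a + 1) <= 1 by rewrite ler_pdivrMr// mul1r lerDl.
  move=> /(ler_wpM2l (sqr_ge0 b)); move: H; rewrite cE.
  by move: (b ^+ 2) (_ / _) => u v; lra.
exists g; split.
- by move=> n p /Dg.
- move=> e e0; have e4 : 0 < e / 4 by rewrite divr_gt0.
  have [n0 _ n0P] := near_infty_natSinv_lt (PosNum e4).
  exists n0 => m n /n0P/= hm /n0P/= hn.
  apply: (le_lt_trans (parallelogram m n)).
  by move: m.+1%:R^-1 n.+1%:R^-1 hm hn => u v; lra.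
- move=> x Dx; apply: (@cvgr_sqr_dist _ _ _ (k x x + 1)) => n.
  have kxx : 0 <= k x x.
    have := @k_psd [:: (1, x)] (fun p => ltac:(by rewrite inE => /eqP ->)).
    by rewrite /h0_sqnorm !big_seq1/= !mul1r.
  apply: quad => // t.
  have Dt : supported (g n ++ h0_scale t [:: (1, x)]).
    apply: supported_cat => //; apply: supported_scale.
    by move=> p; rewrite inE => /eqP ->.
  have := i0_le _ Dt; rewrite /J /Q /F h0_pair_cat h0_pair_scale.
  rewrite !(h0_dot_scalel, h0_dot_scaler, h0_dot_catl, h0_dot_catr).
  rewrite (h0_dotC [:: _] (g n)) h0_dot_eval.
  have -> : h0_dot [:: (1, x)] [:: (1, x)] = k x x.
    by rewrite /h0_dot !big_seq1/= !mul1r.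
  have -> : h0_pair f [:: (1, x)] = f x by rewrite /h0_pair big_seq1 mul1r.
  have := Jg n; rewrite /J /Q /F.
  by move: n.+1%:R^-1 => u; lra.
(* Stationarity in the direction of [g n] itself: Q - F tends to 0, so Q and F both tend to [- i0],
   and the dual bound becomes i0^2 <= Psi^2 (- i0) in the limit. *)
- have u2 n : (Q (g n) - F (g n)) ^+ 2 <= (3 + 4 * Psi ^+ 2) / n.+1%:R.
    apply: (@le_trans _ _ ((Q (g n) + 1) / n.+1%:R)); last first.
      by rewrite ler_pM2r ?invr_gt0//; have := Qbd n; lra.
    apply: quad => [|t]; first exact: Q0.
    have := i0_le _ (supported_cat (Dg n) (supported_scale (c := t) (Dg n))).
    rewrite /J /Q /F h0_pair_cat h0_pair_scale.
    rewrite !(h0_dot_scalel, h0_dot_scaler, h0_dot_catl, h0_dot_catr).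
    have := Jg n; rewrite /J /Q /F.
    by move: n.+1%:R^-1 => u; lra.
  have cu : (fun n => Q (g n) - F (g n)) @ \oo --> (0 : R).
    apply: (@cvgr_sqr_dist _ _ _ (3 + 4 * Psi ^+ 2)) => n.
    by rewrite subr0.
  have cJ : (fun n => J (g n)) @ \oo --> i0.
    apply: (@cvgr_sqr_dist _ _ _ 1) => n; have := Jg n; have := i0_le _ (Dg n).
    have n1 : n.+1%:R^-1 <= 1 :> R by rewrite invf_le1// ler1n.
    have n0 : 0 <= n.+1%:R^-1 :> R by rewrite invr_ge0.
    set x := J _ - i0 => h1 h2; rewrite mul1r.
    have x0 : 0 <= x by rewrite subr_ge0.
    have xn : x <= n.+1%:R^-1 by rewrite lerBlDl ltW.
    apply: (le_trans _ xn); rewrite expr2 ler_piMl//.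
    exact: (le_trans xn n1).
  have cQ : (fun n => Q (g n)) @ \oo --> - i0.
    have -> : (fun n => Q (g n)) =
        (fun n => 2 * (Q (g n) - F (g n)) - J (g n)).
      by apply/funext => n; rewrite /J; ring.
    rewrite -[- i0]add0r -[X in X + _](mulr0 2); apply: cvgB => //.
    by apply: cvgM cu; exact: cvg_cst.
  exists (- i0); split; first exact: cQ.
  have cF : (fun n => (F (g n)) ^+ 2) @ \oo --> (- i0) ^+ 2.
    have cF1 : (fun n => F (g n)) @ \oo --> - i0.
      have -> : (fun n => F (g n)) = (fun n => Q (g n) - (Q (g n) - F (g n))).
        by apply/funext => n; ring.
      by rewrite -[- i0]subr0; exact: cvgB.
    under eq_fun do rewrite expr2.
    by rewrite expr2; exact: cvgM.
  have : (- i0) ^+ 2 <= Psi ^+ 2 * - i0.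
    apply: (ler_cvg_to cF (cvgM (cvg_cst (Psi ^+ 2)) cQ)).
    by near=> n; exact: FQ.
  have [->|i00] := eqVneq i0 0; first by rewrite oppr0 sqr_ge0.
  by rewrite expr2 ler_pM2r// oppr_gt0 lt_neqAle i00.
Unshelve. all: by end_near. Qed.

End RieszRepresentation.

(** * Gaussian mixtures and the Matérn kernel *)

Lemma cvg_sum_seq {R : realType} (I : Type) (s : seq I) (F : I -> nat -> R)
    (l : I -> R) : (forall i, F i @ \oo --> l i) ->
  (fun n => \sum_(i <- s) F i n) @ \oo --> \sum_(i <- s) l i.
Proof.
move=> Fl; elim: s => [|i s IHs].
  by rewrite big_nil; under eq_fun do rewrite big_nil; exact: cvg_cst.
by rewrite big_cons; under eq_fun do rewrite big_cons; exact: cvgD.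
Qed.

(** * Positive semidefinite kernels and the Gaussian kernel *)

Section PositiveSemidefinite.
Context {R : realType} (P : eqType).
Implicit Type k : P -> P -> R.

Definition psd k := forall g, 0 <= h0_sqnorm k g.

Lemma psd_lim (k_ : nat -> P -> P -> R) k :
  (forall n, psd (k_ n)) -> (forall x y, (k_ ^~ x) ^~ y @ \oo --> k x y) ->
  psd k.
Proof.
move=> psdk kk g.
have cQ : (fun n => h0_sqnorm (k_ n) g) @ \oo --> h0_sqnorm k g.
  apply: cvg_sum_seq => p; apply: cvg_sum_seq => q.
  by apply: cvgM; [exact: cvg_cst|exact: kk].
apply: (ler_cvg_to (cvg_cst 0) cQ); apply: nearW => n; exact: psdk.
Qed.

Lemma psd_sum (I : Type) (s : seq I) (k_ : I -> P -> P -> R) :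
  (forall i, psd (k_ i)) -> psd (fun x y => \sum_(i <- s) k_ i x y).
Proof.
move=> psdk g; have -> : h0_sqnorm (fun x y => \sum_(i <- s) k_ i x y) g =
    \sum_(i <- s) h0_sqnorm (k_ i) g.
  rewrite /h0_sqnorm [RHS]exchange_big/=; apply: eq_bigr => p _.
  rewrite [RHS]exchange_big/=; apply: eq_bigr => q _.
  by rewrite mulr_sumr.
by apply: sumr_ge0 => i _; exact: psdk.
Qed.

Lemma psd_scale c k : 0 <= c -> psd k -> psd (fun x y => c * k x y).
Proof.
move=> c0 psdk g; have -> : h0_sqnorm (fun x y => c * k x y) g =
    c * h0_sqnorm k g.
  rewrite /h0_sqnorm mulr_sumr; apply: eq_bigr => p _.
  by rewrite mulr_sumr; apply: eq_bigr => q _; ring.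
exact: mulr_ge0.
Qed.

Lemma psd_conj (b : P -> R) k : psd k -> psd (fun x y => b x * b y * k x y).
Proof.
move=> psdk g; have := psdk [seq (p.1 * b p.2, p.2) | p <- g].
rewrite /h0_sqnorm big_map; congr (0 <= _); apply: eq_bigr => p _.
by rewrite big_map; apply: eq_bigr => q _ /=; ring.
Qed.

(** The squared norm of g + t k(c, .) is a nonnegative quadratic in t; if k(c, c) = 0, a suitable t
    forces the pairing to vanish. *)
Lemma psd_cauchy_schwarz k c g : psd k -> (forall x y, k x y = k y x) ->
  h0_pair (k c) g ^+ 2 <= k c c * h0_sqnorm k g.
Proof.
move=> psdk sym.
have quad t : 0 <= h0_sqnorm k g + 2 * t * h0_pair (k c) g + t ^+ 2 * k c c.
  have := psdk ((t, c) :: g); rewrite /h0_sqnorm big_cons big_cons/=.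
  under [X in _ + X]eq_bigr do rewrite big_cons/=.
  rewrite big_split/= => /le_trans; apply; rewrite le_eqVlt; apply/predU1P; left.
  rewrite (_ : \sum_(q <- g) t * q.1 * k c q.2 = t * h0_pair (k c) g).
    rewrite (_ : \sum_(q <- g) q.1 * t * k q.2 c = t * h0_pair (k c) g).
      by ring.
    rewrite /h0_pair mulr_sumr; apply: eq_bigr => q _.
    by rewrite (sym q.2); ring.
  by rewrite /h0_pair mulr_sumr; apply: eq_bigr => q _; ring.
set a := k c c; set b := h0_pair _ _; set q := h0_sqnorm _ _.
rewrite -/a -/b -/q in quad.
have q0 : 0 <= q by exact: psdk.
have a0 : 0 <= a.
  by have := psdk [:: (1, c)]; rewrite /h0_sqnorm !big_seq1/= !mul1r.
have [a_0|ane0] := eqVneq a 0.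
  have [->|b0] := eqVneq b 0; first by rewrite expr0n/= mulr_ge0.
  have := quad (- (q + 1) / (2 * b)); rewrite a_0 mulr0 addr0.
  rewrite (_ : q + _ = - 1); last by field.
  by rewrite ler0N1.
have a1 : 0 < a by rewrite lt_neqAle eq_sym ane0.
have := quad (- b / a); rewrite -(pmulr_rge0 _ a1).
rewrite (_ : a * (_ + _) = a * q - b ^+ 2) ?subr_ge0//.
by field.
Qed.

End PositiveSemidefinite.

Section GaussianKernel.
Context {R : realType} (D : nat).
Implicit Types x y : D.-tuple R.

Definition gaussian_kernel (a : R) x y : R := expR (- (a * sqdist x y)).

Lemma sqdistC x y : sqdist x y = sqdist y x.
Proof. by apply: eq_bigr => i _; rewrite -sqrrN opprB. Qed.

Lemma sqdist_ge0 x y : 0 <= sqdist x y.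
Proof. by apply: sumr_ge0 => i _; exact: sqr_ge0. Qed.

Lemma sqdistxx x : sqdist x x = 0.
Proof. by apply: big1 => i _; rewrite subrr expr0n. Qed.

Let dot x y := \sum_(i < D) tnth x i * tnth y i.

(** One factor [dot x y] is a sum over coordinates of x_i y_i, each of which conjugates the previous
    power; no general product of kernels is needed. *)
Let psd_dot_exp n : psd (fun x y => dot x y ^+ n).
Proof.
elim: n => [|n IHn] g.
  rewrite /h0_sqnorm (_ : \sum_(p <- g) _ = (\sum_(p <- g) p.1) ^+ 2).
    exact: sqr_ge0.
  rewrite expr2 mulr_suml; apply: eq_bigr => p _; rewrite mulr_sumr.
  by apply: eq_bigr => q _; rewrite expr0 mulr1.
have := @psd_sum R _ _ (index_enum 'I_D)
  (fun i x y => tnth x i * tnth y i * dot x y ^+ n)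
  (fun i => psd_conj (fun x => tnth x i) IHn) g.
congr (0 <= h0_sqnorm _ _); apply/funext => x; apply/funext => y.
by rewrite exprS -mulr_suml.
Qed.

(** Expanding |x - y|^2, the mixed term gives an exponential series with nonnegative coefficients in
    [dot], and the factors e^(- a |x|^2) conjugate it. *)
Lemma psd_gaussian_kernel a : 0 <= a -> psd (gaussian_kernel a).
Proof.
move=> a0; have psdE : psd (fun x y => expR (2 * a * dot x y)).
  apply: (@psd_lim _ _ (fun n x y => series (exp_coeff (2 * a * dot x y)) n)).
    move=> n; apply: psd_sum => i.
    rewrite (_ : (fun x y => _) = fun x y =>
        (2 * a) ^+ i / i`!%:R * dot x y ^+ i).
      apply: psd_scale; last exact: psd_dot_exp.
      by rewrite divr_ge0// exprn_ge0// mulr_ge0.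
    apply/funext => x; apply/funext => y.
    by rewrite /exp_coeff/= exprMn; ring.
  by move=> x y; exact: is_cvg_series_exp_coeff.
have := psd_conj (fun x => expR (- (a * dot x x))) psdE.
congr psd; apply/funext => x; apply/funext => y.
rewrite -!expRD /gaussian_kernel; congr expR.
have -> : sqdist x y = dot x x + dot y y - 2 * dot x y.
  rewrite /sqdist /dot mulr_sumr -big_split -sumrB/=.
  by apply: eq_bigr => i _; ring.
by ring.
Qed.

End GaussianKernel.

(** Completing the square bounds - kappa z^2 by both c + z and c - z, so on each side of [y] a
    geometric series dominates; e >= 2 closes the inductions. *)
Lemma grid_sum_bound {R : realType} (kappa : R) : 0 < kappa ->
  exists2 C : R, 0 < C & forall n (y : R),
    \sum_(j < n) expR (- (kappa * (y - j%:R) ^+ 2)) <= C.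
Proof.
move=> kappa0; pose c := (4 * kappa)^-1.
exists (expR c * (expR 1 + 2)).
  by rewrite mulr_gt0 ?expR_gt0// addr_gt0 ?expR_gt0.
move=> n y.
have e2 : 2 <= expR 1 :> R by have := expR_ge1Dx (1 : R); lra.
pose lo n := \sum_(j < n | j%:R <= y) expR (j%:R - y).
pose hi n := \sum_(j < n | ~~ (j%:R <= y)) expR (y - j%:R).
have lo_le m : lo m <= expR 1.
  have lo_full p : (p%:R - 1 <= y) -> lo p <= expR (p%:R - y).
    elim: p => [|p IHp] py; first by rewrite /lo big_ord0 expR_ge0.
    rewrite /lo big_mkcond big_ord_recr -big_mkcond/= -/(lo p).
    have py' : p%:R <= y by move: py; rewrite -natr1; lra.
    rewrite py' -natr1 (_ : p%:R + 1 - y = 1 + (p%:R - y)); last by ring.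
    rewrite (expRD 1); have := IHp ltac:(lra).
    have := ler_wpM2r (expR_ge0 (p%:R - y)) e2; lra.
  elim: m => [|m IHm]; first by rewrite /lo big_ord0 expR_ge0.
  have [my|my] := lerP m%:R y.
    apply: le_trans (lo_full m.+1 _) _; rewrite -natr1; first by lra.
    by rewrite ler_expR; lra.
  by rewrite /lo big_mkcond big_ord_recr -big_mkcond/= -/(lo m) (lt_geF my) addr0.
(* The second half is the invariant: 2 e^(y - m) reserves room for the terms still to come. *)
have hi_le m : hi m <= 2 /\ (y < m%:R -> hi m + 2 * expR (y - m%:R) <= 2).
  elim: m => [|m [IH1 IH2]].
    rewrite /hi big_ord0; split => // y0; rewrite add0r subr0.
    have : expR y <= 1 by rewrite expR_le1 ltW.
    by lra.
  rewrite /hi big_mkcond big_ord_recr -big_mkcond/= -/(hi m) -(natr1 m).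
  have eS : 2 * expR (y - (m%:R + 1)) <= expR (y - m%:R).
    rewrite (_ : y - m%:R = 1 + (y - (m%:R + 1))); last by ring.
    rewrite [leRHS]expRD.
    by rewrite ler_wpM2r ?expR_ge0.
  have [my|my] := lerP m%:R y; rewrite ?addr0 /=.
    split => // y0.
    have hi0 : hi m = 0.
      apply: big1 => j /negP[]; apply: le_trans my.
      by rewrite ler_nat ltnW.
    rewrite hi0 add0r.
    have : expR (y - (m%:R + 1)) <= 1 by rewrite expR_le1; lra.
    by lra.
  have := IH2 my; have := expR_gt0 (y - m%:R); have := expR_gt0 (y - (m%:R + 1)).
  by move=> ? ? ?; split => [|_]; lra.
apply: (@le_trans _ _ (expR c * (lo n + hi n))); last first.
  rewrite ler_pM2l ?expR_gt0//; apply: lerD; first exact: lo_le.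
  by have [] := hi_le n.
rewrite (bigID (fun j : 'I_n => j%:R <= y))/= mulrDr /lo /hi !mulr_sumr.
have bound z : - (kappa * z ^+ 2) <= c + z.
  have : 0 <= kappa * (z + (2 * kappa)^-1) ^+ 2.
    by rewrite mulr_ge0 ?sqr_ge0// ltW.
  rewrite (_ : kappa * _ = kappa * z ^+ 2 + z + c); first by lra.
  by rewrite /c; field; lra.
apply: lerD; apply: ler_sum => j _; rewrite -expRD ler_expR.
  by have := bound (j%:R - y); rewrite -sqrrN opprB.
exact: bound.
Qed.

(** * The Matérn kernel as a mixture of Gaussians *)

Section MaternMixture.
Context {R : realType}.
Variable nu : R.
Hypothesis nu0 : 0 < nu.
Let mu := @lebesgue_measure R.

(** With s = e^t this is s^(nu - 1) e^(- s - b / s) ds. For b proportional to r^2, the last factor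
    is a Gaussian in r of width of order e^(t / 2). *)
Definition mixture (b t : R) : R :=
  expR (nu * t - expR t - b * expR (- t)).

Lemma mixture_ge0 b t : 0 <= mixture b t.
Proof. exact: expR_ge0. Qed.

Lemma continuous_mixture b : continuous (mixture b).
Proof.
have cexp := @continuous_expR R.
move=> t; apply: continuous_comp; last exact: cexp.
apply: cvgB; first apply: cvgB.
- by apply: cvgM; [exact: cvg_cst|exact: cvg_id].
- exact: cexp.
- apply: cvgM; first exact: cvg_cst.
  apply: (continuous_comp (f := -%R) (g := @expR R)); last exact: cexp.
  exact: opp_continuous.
Qed.

Lemma measurable_mixture b (D : set R) : measurable_fun D (mixture b).
Proof.
apply: measurable_funTS; apply: continuous_measurable_fun.
exact: continuous_mixture.
Qed.

Lemma mixture_le b b' t : b' <= b -> mixture b t <= mixture b' t.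
Proof.
move=> bb; rewrite ler_expR lerB// ler_wpM2r//; exact: expR_ge0.
Qed.

(** For t >= 0 it follows from e^t >= t^2 / 2 and (t - 2 nu)^2 >= 0. The two-sided exponential is
    the integrable majorant. *)
Let mixture0_le t : mixture 0 t <= expR (2 * nu ^+ 2) * expR (- (nu * `|t|)).
Proof.
rewrite -expRD ler_expR mul0r subr0.
have [t0|t0] := lerP 0 t.
  rewrite ger0_norm//.
  have : t ^+ 2 / 2 <= expR t.
    by have := expR_ge1Dxn 1 t0; rewrite (_ : 2`! = 2)%N//; lra.
  have := sqr_ge0 (t - 2 * nu); rewrite sqrrB !expr2; lra.
rewrite ltr0_norm//; have := expR_gt0 t; have := sqr_ge0 nu; lra.
Qed.

Lemma ge0_integral_opp (f : R -> \bar R) :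
  measurable_fun setT f -> (forall x, (0 <= f x)%E) ->
  (\int[mu]_x f (- x)%R = \int[mu]_x f x)%E.
Proof.
move=> mf f0.
have mN : measurable_fun setT (-%R : measurableTypeR R -> measurableTypeR R).
  exact: oppr_measurable.
rewrite [RHS](_ : _ = \int[pushforward mu
    (-%R : measurableTypeR R -> measurableTypeR R)]_x f x)%E; last first.
  by apply: eq_measure_integral => A mA _; exact/esym/lebesgue_measureN.
by rewrite ge0_integral_pushforward.
Qed.

Lemma integrable_mixture b : 0 <= b -> mu.-integrable setT (EFin \o mixture b).
Proof.
move=> b0.
pose f t := exponential_pdf nu t.
have f0 t : 0 <= f t by apply: exponential_pdf_ge0; exact: ltW.
have mf : measurable_fun setT f by exact: measurable_exponential_pdf.
have mfN : measurable_fun setT (fun t : R => f (- t)).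
  by apply: (measurableT_comp mf); exact: oppr_measurable.
have if1 : mu.-integrable setT (EFin \o f) by exact: integrable_exponential_pdf.
have if2 : mu.-integrable setT (fun t : R => (f (- t))%:E).
  apply/integrableP; split; first exact/measurable_EFinP.
  under eq_integral do rewrite gee0_abs ?lee_fin//.
  rewrite (ge0_integral_opp (f := EFin \o f)).
  - by rewrite integral_exponential_pdf// ltry.
  - exact/measurable_EFinP.
  - by move=> x; rewrite lee_fin.
pose C := expR (2 * nu ^+ 2) / nu.
have C0 : 0 <= C by rewrite divr_ge0 ?expR_ge0// ltW.
have ih := integrableZl measurableT C (integrableD measurableT if1 if2).
apply: le_integrable ih => //.
  by apply/measurable_EFinP; exact: measurable_mixture.
move=> t _ /=; rewrite lee_fin !ger0_norm ?mixture_ge0 ?mulr_ge0 ?addr_ge0//.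
apply: le_trans (mixture_le _ b0) _; apply: le_trans (mixture0_le t) _.
rewrite /C -mulrA ler_wpM2l ?expR_ge0// [leRHS]mulrC ler_pdivlMr//.
have [t0|t0] := lerP 0 t.
  rewrite ger0_norm// {1}/f exponential_pdfE// mulrC mulNr.
  by rewrite lerDl f0.
rewrite ltr0_norm// [in X in _ <= _ + X]/f exponential_pdfE ?oppr_ge0 ?(ltW t0)//.
  by rewrite [leLHS]mulrC -mulNr lerDr f0.
by rewrite invr_ge0 ltW.
Qed.

Lemma integral_mixture_fin b : 0 <= b ->
  (\int[mu]_t (mixture b t)%:E)%E = (\int[mu]_(t in setT) mixture b t)%:E.
Proof.
move=> b0; rewrite /Rintegral fineK//.
exact: integrable_fin_num (integrable_mixture b0).
Qed.

(** The substitution e^t on the intervals [- n, n], followed by monotone convergence. *)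
Lemma Gamma_mixture : Gamma_ nu = \int[mu]_(t in setT) mixture 0 t.
Proof.
congr fine; pose G (t : R) := t `^ (nu - 1) * expR (- t).
have cG t : 0 < t -> {for t, continuous G}.
  move=> t0; apply: cvgM.
    have dp : derivable (@powR R ^~ (nu - 1)) t 1.
      by apply: derivable_powR; rewrite in_itv/= t0.
    exact/(differentiable_continuous (f := @powR R ^~ (nu - 1)))/derivable1_diffP.
  apply: (continuous_comp (f := -%R) (g := @expR R)).
    exact: opp_continuous.
  exact: continuous_expR.
have mG : measurable_fun (`]0, +oo[%classic : set R) G.
  apply: measurable_funM; first exact: measurable_funTS.
  apply: measurable_funTS; apply: measurableT_comp => //.
pose E (n : nat) : set R := `[expR (- n%:R), expR n%:R]%classic.
pose F (n : nat) : set R := `[- n%:R, n%:R]%classic.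
have EF n : (\int[mu]_(t in E n) (G t)%:E = \int[mu]_(t in F n) (mixture 0 t)%:E)%E.
  have dexp : (@expR R)^`()%classic = expR.
    by apply/funext => x; rewrite derive1E; exact: (congr1 (@^~ x) (@derive_expR R)).
  rewrite (@integration_by_substitution_increasing R expR G (- n%:R) n%:R).
  - apply: eq_integral => t _; congr EFin; rewrite dexp.
    rewrite [LHS](_ : _ = expR t `^ (nu - 1) * expR (- expR t) * expR t)//.
    by rewrite -expRM -!expRD /mixture; congr expR; ring.
  - by rewrite (@le_trans _ _ 0)// oppr_le0.
  - by move=> x y _ _ xy; rewrite ltr_expR.
  - by rewrite dexp => x _; exact: continuous_expR.
  - rewrite dexp; apply/cvg_ex; exists (expR (- n%:R)).
    by apply: cvg_at_right_filter; exact: continuous_expR.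
  - rewrite dexp; apply/cvg_ex; exists (expR n%:R).
    by apply: cvg_at_left_filter; exact: continuous_expR.
  - split; first by move=> x _; exact: derivable_expR.
      by apply: cvg_at_right_filter; exact: continuous_expR.
    by apply: cvg_at_left_filter; exact: continuous_expR.
  - apply: continuous_in_subspaceT => x; rewrite inE/= in_itv/= => /andP[nx _].
    by apply: cG; apply: lt_le_trans nx; exact: expR_gt0.
have UE : \bigcup_n E n = `]0, +oo[%classic.
  apply/seteqP; split => [t [n _]|t]; rewrite /E/= !in_itv/=.
    by move=> /andP[+ _]; rewrite andbT; apply: lt_le_trans; exact: expR_gt0.
  rewrite andbT => t0; pose n := (Num.truncn `|ln t|).+1.
  have tn : `|ln t| <= n%:R by apply: ltW; exact: truncnS_gt.
  exists n => //=; rewrite in_itv/=.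
  move: tn; rewrite ler_norml => /andP[].
  by rewrite -ler_expR -[ln t <= _]ler_expR lnK ?posrE// => -> ->.
have UF : \bigcup_n F n = setT.
  apply/seteqP; split => // t _; pose n := (Num.truncn `|t|).+1.
  have tn : `|t| <= n%:R by apply: ltW; exact: truncnS_gt.
  by exists n => //=; rewrite /F/= in_itv/= -ler_norml.
have cE : (\int[mu]_(t in E n) (G t)%:E)%E @[n --> \oo] -->
    (\int[mu]_(t in `]0%R, +oo[) (G t)%:E)%E.
  rewrite -UE; apply: ge0_nondecreasing_set_cvg_integral => //.
  - move=> m n mn; rewrite subsetEset /E => t /=; rewrite !in_itv/=.
    move=> /andP[t1 t2]; rewrite (le_trans _ t1) ?(le_trans t2)//.
      by rewrite ler_expR ler_nat.
    by rewrite ler_expR lerN2 ler_nat.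
  - by move=> n; exact: measurable_itv.
  - move=> n; apply/measurable_EFinP; apply: measurable_funS mG => //.
    by rewrite -UE; exact: bigcup_sup.
  - by move=> n x _; rewrite lee_fin mulr_ge0 ?powR_ge0 ?expR_ge0.
have cF : (\int[mu]_(t in F n) (mixture 0 t)%:E)%E @[n --> \oo] -->
    (\int[mu]_t (mixture 0 t)%:E)%E.
  rewrite -UF; apply: ge0_nondecreasing_set_cvg_integral => //.
  - move=> m n mn; rewrite subsetEset /F => t /=; rewrite !in_itv/=.
    move=> /andP[t1 t2]; rewrite (le_trans _ t1) ?(le_trans t2)//.
      by rewrite ler_nat.
    by rewrite lerN2 ler_nat.
  - by move=> n; exact: measurable_itv.
  - by move=> n; apply/measurable_EFinP; exact: measurable_mixture.
  - by move=> n x _; rewrite lee_fin mixture_ge0.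
rewrite (funext EF) in cE.
exact: (cvg_unique _ cE cF).
Qed.

End MaternMixture.

Section BesselMixture.
Context {R : realType}.
Variable nu : R.
Hypothesis nu0 : 0 < nu.
Let mu := @lebesgue_measure R.

Lemma continuous_cosh : continuous (@cosh_ R).
Proof.
move=> t; apply: cvgM; last exact: cvg_cst.
apply: cvgD; first exact: continuous_expR.
apply: (continuous_comp (f := -%R) (g := @expR R)).
  exact: opp_continuous.
exact: continuous_expR.
Qed.

Lemma coshN (t : R) : cosh_ (- t) = cosh_ t.
Proof. by rewrite /cosh_ opprK addrC. Qed.

Lemma cosh_gt0 (t : R) : 0 < cosh_ t.
Proof. by rewrite divr_gt0// addr_gt0// expR_gt0. Qed.

(** The integrand is even, so the half line carries half of the integral and cosh (nu t) may be
    replaced by e^(nu t). The shift by ln (2 / u) turns u cosh t into e^t + (u^2 / 4) e^(- t). *)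
Lemma besselK_mixture (u : R) : 0 < u ->
  2 `^ (1 - nu) * u `^ nu * besselK nu u =
  \int[mu]_(t in setT) mixture nu (u ^+ 2 / 4) t.
Proof.
move=> u0; pose f t := expR (- u * cosh_ t) * cosh_ (nu * t).
pose h t := expR (- u * cosh_ t + nu * t).
have ccosh c : continuous (fun t : R => cosh_ (c * t)).
  move=> t; apply: continuous_comp; last exact: continuous_cosh.
  by apply: cvgM; [exact: cvg_cst|exact: cvg_id].
have cucosh : continuous (fun t : R => - u * cosh_ t).
  by move=> t; apply: cvgM; [exact: cvg_cst|exact: continuous_cosh].
have cf : continuous f.
  move=> t; apply: cvgM; last exact: ccosh.
  apply: (continuous_comp (f := fun t => - u * cosh_ t)); first exact: cucosh.
  exact: continuous_expR.
have mh : measurable_fun setT h.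
  apply: continuous_measurable_fun => t.
  apply: (continuous_comp (f := fun t => - u * cosh_ t + nu * t)).
    apply: cvgD; first exact: cucosh.
    by apply: cvgM; [exact: cvg_cst|exact: cvg_id].
  exact: continuous_expR.
have f0 t : 0 <= f t by rewrite mulr_ge0 ?expR_ge0// ltW// cosh_gt0.
have h0 t : 0 <= h t by exact: expR_ge0.
have fN : f =1 f \o -%R by move=> t; rewrite /f /= mulrN !coshN.
have fhE t : f t = 2^-1 * h t + 2^-1 * h (- t).
  rewrite /f /h coshN mulrN !expRD /cosh_ -[nu * t]/(nu * t).
  by rewrite mulrDl mulrDr; field.
have mEh : measurable_fun setT (EFin \o h) by exact/measurable_EFinP.
have fhI : (\int[mu]_t (f t)%:E = \int[mu]_t (h t)%:E)%E.
  transitivity (\int[mu]_t ((2^-1)%:E * (h t)%:E + (2^-1)%:E * (h (- t))%:E))%E.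
    by apply: eq_integral => t _; rewrite -!EFinM -EFinD fhE.
  have mhN : measurable_fun setT (fun t : R => (h (- t))%:E).
    apply/measurable_EFinP; apply: (measurableT_comp mh).
    exact: oppr_measurable.
  rewrite ge0_integralD//=; last 4 first.
  - by move=> t _; rewrite mule_ge0// lee_fin.
  - by apply: emeasurable_funM => //; exact: measurable_cst.
  - by move=> t _; rewrite mule_ge0// lee_fin.
  - by apply: emeasurable_funM => //; exact: measurable_cst.
  rewrite ge0_integralZl//=; last by move=> t _; rewrite lee_fin.
  rewrite ge0_integralZl//=; last by move=> t _; rewrite lee_fin.
  rewrite (ge0_integral_opp (f := EFin \o h))//.
  rewrite -ge0_muleDl ?lee_fin//.
  by rewrite -EFinD (_ : 2^-1 + 2^-1 = 1) ?mul1e//; field.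
pose a := ln (2 / u).
have ea : expR a = 2 / u by rewrite lnK// posrE divr_gt0.
have hI : (\int[mu]_t (h t)%:E =
    ((2 / u) `^ nu)%:E * \int[mu]_t (mixture nu (u ^+ 2 / 4) t)%:E)%E.
  rewrite -(ge0_integral_shift a mEh)//.
  rewrite -ge0_integralZl//; last 3 first.
  - apply/measurable_EFinP; exact: measurable_mixture.
  - by move=> t _; rewrite lee_fin mixture_ge0.
  - by rewrite lee_fin powR_ge0.
  apply: eq_integral => t _; rewrite -EFinM; congr EFin.
  rewrite /h /mixture -ea -expRM -expRD; congr expR.
  have e1 : expR (a + t) = 2 / u * expR t by rewrite expRD ea.
  have e2 : expR (- (a + t)) = u / 2 * expR (- t).
    by rewrite opprD expRD (expRN a) ea invf_div.
  by rewrite /cosh_ e1 e2; field; rewrite gt_eqF.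
have fI0 : (2%:E * \int[mu]_(t in `[0%R, +oo[) (f t)%:E =
    \int[mu]_t (f t)%:E)%E.
  by rewrite ge0_symfun_integralT// -set_itvcy.
have b0 : 0 <= u ^+ 2 / 4 by rewrite divr_ge0// sqr_ge0.
rewrite -[besselK nu u]/(fine (\int[mu]_(t in `[0%R, +oo[) (f t)%:E)).
move: fI0; rewrite fhI hI (integral_mixture_fin nu0 b0) -EFinM.
set I := (\int[mu]_(t in setT) _); set J := (\int[mu]_(t in _) _)%E.
have J0 : (0 <= J)%E by apply: integral_ge0 => t _; rewrite lee_fin.
case: J J0 => [r|//|//] _; last by rewrite mulry gtr0_sg// mul1e.
rewrite -EFinM => -[rE] /=; rewrite (_ : r = 2^-1 * ((2 / u) `^ nu * I)); last first.
  by rewrite -rE; field.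
have -> : 2 `^ (1 - nu) = 2 / 2 `^ nu :> R by rewrite powRB ?powRr1// pnatr_eq0 implybT.
have -> : (2 / u) `^ nu = 2 `^ nu / u `^ nu.
  rewrite powRM ?invr_ge0 ?(ltW u0)//; congr (_ * _).
  by rewrite -powR_inv1 ?(ltW u0)// -powRrM mulN1r powRN.
by field; rewrite !powR_eq0 (gt_eqF u0)/= pnatr_eq0.
Qed.

End BesselMixture.

Definition hard_family {R : realType} (D : nat)
    (k : D.-tuple R -> D.-tuple R -> R) (Psi C h : R) (n : nat) : Prop :=
  exists f : {ffun 'I_D -> 'I_n} -> D.-tuple R -> R,
  [/\ forall m, measurable_fun setT (f m),
      forall m, rkhs_ball k (@cube R D) Psi (f m),
      forall m, exists2 c, (@cube R D) c & 2 * h <= f m c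
    & forall x, (@cube R D) x -> \sum_m f m x ^+ 2 <= C * h ^+ 2].

Lemma measurable_sqdist {R : realType} (D : nat) (c : D.-tuple R) :
  measurable_fun setT (sqdist c).
Proof.
apply: measurable_sum => i; apply: measurable_funX.
by apply: measurable_funB => //; exact: measurable_tnth.
Qed.

(** * Bumps for the Matérn kernel *)

Section MaternFamily.
Context {R : realType} (D : nat).
Variables (l nu : R).
Hypothesis l0 : 0 < l.
Hypothesis nu0 : 0 < nu.
Let mu := @lebesgue_measure R.
Implicit Types x y c : D.-tuple R.

Let rho := nu / (2 * l ^+ 2).

Let rho0 : 0 < rho.
Proof. by rewrite divr_gt0// mulr_gt0// exprn_gt0. Qed.

Let rho_sqdist_ge0 x y : 0 <= rho * sqdist x y.
Proof. by rewrite mulr_ge0 ?sqdist_ge0// ltW. Qed.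

Let integrable_mixture_sub (E : set R) b : measurable E -> 0 <= b ->
  mu.-integrable E (EFin \o mixture nu b).
Proof.
move=> mE b0; apply: integrableS (integrable_mixture nu0 b0) => //.
Qed.

Definition matern_part (E : set R) x y : R :=
  (Gamma_ nu)^-1 * \int[mu]_(t in E) mixture nu (rho * sqdist x y) t.

(** On [theta - 1, theta] the integrand is at least this constant, since e^t <= 1 there. It bounds
    the diagonal of the truncated kernel from below. *)
Lemma mixture_lower_bound (theta : R) : theta <= 0 ->
  expR (nu * (theta - 1) - 1) <=
  \int[mu]_(t in `]-oo, theta]) mixture nu 0 t.
Proof.
move=> theta0; rewrite -lee_fin /Rintegral fineK; last first.
  by apply: integrable_fin_num => //; exact: integrable_mixture_sub.
pose J : set R := `[theta - 1, theta]%classic.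
have mJ : measurable J by exact: measurable_itv.
apply: (@le_trans _ _ (\int[mu]_(t in J) (mixture nu 0 t)%:E)%E); last first.
  apply: ge0_subset_integral => //.
  - by apply/measurable_EFinP; exact: measurable_mixture.
  - by move=> t _; rewrite lee_fin mixture_ge0.
  - by move=> t; rewrite /J/= !in_itv/= => /andP[].
apply: (@le_trans _ _ (\int[mu]_(t in J)
    (cst (expR (nu * (theta - 1) - 1))%:E t))%E).
  rewrite integral_cst//= lebesgue_measure_itv/= lte_fin ltrBlDr ltrDl ltr01.
  by rewrite -EFinB -EFinM lee_fin subKr mulr1.
apply: ge0_le_integral => //=.
- by apply/measurable_EFinP; exact: measurable_mixture.
move=> t; rewrite /J/= in_itv/= => /andP[t1 t2]; rewrite lee_fin ler_expR.
rewrite mul0r subr0; apply: lerB; first by rewrite ler_pM2l.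
by rewrite expR_le1 (le_trans t2).
Qed.

Lemma Gamma_gt0 : 0 < Gamma_ nu.
Proof.
rewrite Gamma_mixture//; apply: lt_le_trans (expR_gt0 _) _.
apply: le_trans (mixture_lower_bound (lexx 0)) _.
rewrite -lee_fin /Rintegral !fineK; first last.
- by apply: integrable_fin_num => //; exact: integrable_mixture_sub.
- by apply: integrable_fin_num => //; exact: integrable_mixture_sub.
apply: ge0_subset_integral => //.
  by apply/measurable_EFinP; exact: measurable_mixture.
by move=> t _; rewrite lee_fin mixture_ge0.
Qed.

Lemma k_Matern_mixture x y : k_Matern l nu x y = matern_part setT x y.
Proof.
rewrite /k_Matern /matern_part; have [r0|r0] := eqVneq.
  have -> : sqdist x y = 0.
    apply/eqP; rewrite eq_le sqdist_ge0 andbT.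
    by rewrite -sqrtr_eq0 r0.
  by rewrite mulr0 -Gamma_mixture// mulVf// gt_eqF ?Gamma_gt0.
have r1 : 0 < Num.sqrt (sqdist x y) by rewrite lt_neqAle eq_sym r0 sqrtr_ge0.
set u := _ / l.
have u0 : 0 < u by rewrite divr_gt0// mulr_gt0// sqrtr_gt0 mulr_gt0.
have -> : rho * sqdist x y = u ^+ 2 / 4.
  rewrite /u !exprMn !sqr_sqrtr ?sqdist_ge0 ?mulr_ge0 ?(ltW nu0)//.
  by rewrite /rho; field; rewrite gt_eqF.
by rewrite -besselK_mixture//; ring.
Qed.

Lemma matern_part_sym E x y : matern_part E x y = matern_part E y x.
Proof. by rewrite /matern_part sqdistC. Qed.

(** An integral of positive multiples of Gaussian kernels; integrability moves the finite sums under
    the integral. *)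
Lemma psd_matern_part E : measurable E -> psd (matern_part E).
Proof.
move=> mE; apply: psd_scale; first by rewrite invr_ge0 ltW// Gamma_gt0.
move=> g; have iM (p q : R * D.-tuple R) : mu.-integrable E
    (fun t => (p.1 * q.1 * mixture nu (rho * sqdist p.2 q.2) t)%:E).
  under eq_fun do rewrite EFinM.
  apply: (@integrableZl _ _ _ mu _ mE).
  exact: integrable_mixture_sub.
have iS (p : R * D.-tuple R) : mu.-integrable E
    (fun t => (\sum_(q <- g) p.1 * q.1 * mixture nu (rho * sqdist p.2 q.2) t)%:E).
  under eq_fun do rewrite -sumEFin.
  exact: (@integrable_sum _ _ _ mu _ mE _ g xpredT _ (fun q _ => iM p q)).
rewrite (_ : h0_sqnorm _ g = \int[mu]_(t in E) (\sum_(p <- g) \sum_(q <- g)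
  p.1 * q.1 * mixture nu (rho * sqdist p.2 q.2) t)); last first.
  rewrite /Rintegral; under eq_integral do rewrite -sumEFin.
  rewrite (@integral_sum _ _ _ mu _ mE _ _ iS) -sum_fine; last first.
    by move=> p _; exact: (@integrable_fin_num _ _ _ mu _ mE _ (iS p)).
  apply: eq_bigr => p _; under eq_integral do rewrite -sumEFin.
  rewrite (@integral_sum _ _ _ mu _ mE _ _ (iM p)) -sum_fine; last first.
    by move=> q _; exact: (@integrable_fin_num _ _ _ mu _ mE _ (iM p q)).
  apply: eq_bigr => q _; rewrite -[RHS]/(Rintegral _ _ _) (@RintegralZl _ _ _ mu _ _ _ mE)//.
  by apply: integrable_mixture_sub => //; exact: rho_sqdist_ge0.
apply: Rintegral_ge0 => t _.
have := @psd_gaussian_kernel R D (rho * expR (- t)).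
move=> /(_ ltac:(by rewrite mulr_ge0 ?expR_ge0// ltW)).
move=> /(psd_scale (expR_ge0 (nu * t - expR t))) /(_ g).
congr (0 <= _); apply: eq_bigr => p _; apply: eq_bigr => q _.
by rewrite -expRD; congr (_ * expR _); ring.
Qed.

Lemma matern_part_split (theta : R) x y :
  k_Matern l nu x y =
  matern_part `]-oo, theta] x y + matern_part `]theta, +oo[ x y.
Proof.
rewrite k_Matern_mixture /matern_part -mulrDr; congr (_ * _).
have <- : `]-oo, theta]%classic `|` `]theta, +oo[%classic = [set: R].
  by rewrite -setCitvl setUv.
rewrite Rintegral_setU//.
- apply: integrable_mixture_sub; last exact: rho_sqdist_ge0.
  by apply: measurableU; exact: measurable_itv.
- apply/disj_setPS => t /= []; rewrite !in_itv/= andbT => t1.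
  by rewrite ltNge t1.
Qed.

(** The widest Gaussian left is the one at [theta]; it bounds the others and comes out of the
    integral. *)
Lemma matern_part_decay (theta : R) x y :
  0 <= matern_part `]-oo, theta] x y <= matern_part `]-oo, theta] x x *
    expR (- (rho * expR (- theta) * sqdist x y)).
Proof.
have G0 : 0 <= (Gamma_ nu)^-1 by rewrite invr_ge0 ltW// Gamma_gt0.
apply/andP; split.
  by rewrite mulr_ge0// Rintegral_ge0// => t _; exact: mixture_ge0.
rewrite /matern_part sqdistxx mulr0 -[leRHS]mulrA ler_wpM2l//.
rewrite -RintegralZr//; last exact: integrable_mixture_sub.
apply: le_Rintegral => //.
- by apply: integrable_mixture_sub => //; exact: rho_sqdist_ge0.
- have mI : measurable (`]-oo, theta]%classic : set R) by [].
  have iI := integrable_mixture_sub mI (lexx 0).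
  have := @integrableZr _ _ _ mu _ mI
    (expR (- (rho * expR (- theta) * sqdist x y))) _ iI.
  by apply: eq_integrable => // t _; rewrite /= EFinM.
move=> t; rewrite /= in_itv/= => tt; rewrite -expRD ler_expR.
rewrite mul0r subr0 lerD2l lerN2 mulrAC ler_wpM2l ?rho_sqdist_ge0//.
by rewrite ler_expR lerN2.
Qed.

Lemma k_Matern_sym x y : k_Matern l nu x y = k_Matern l nu y x.
Proof. by rewrite !k_Matern_mixture matern_part_sym. Qed.

Lemma h0_sqnormD (k k' : D.-tuple R -> D.-tuple R -> R) g :
  h0_sqnorm (fun x y => k x y + k' x y) g = h0_sqnorm k g + h0_sqnorm k' g.
Proof.
rewrite -big_split; apply: eq_bigr => p _; rewrite -big_split.
by apply: eq_bigr => q _; rewrite mulrDr.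
Qed.

(* The kernel splits as a sum of two mixtures of Gaussians; the Gaussians of
   width at most 1/n form a kernel k0 below k, so |k0(c, .)|_k^2 <= k0(c, c). *)
Lemma matern_bump (theta A Psi : R) c :
  A ^+ 2 * matern_part `]-oo, theta] c c <= Psi ^+ 2 ->
  rkhs_ball (@k_Matern R l nu D) (@cube R D) Psi
    (fun x => A * matern_part `]-oo, theta] c x).
Proof.
set k0 := matern_part _ => A2.
have psd0 : psd k0 by exact: psd_matern_part.
have kE : @k_Matern R l nu D = fun x y => k0 x y + matern_part `]theta, +oo[ x y.
  by apply/funext => x; apply/funext => y; exact: matern_part_split.
have k0_le g : h0_sqnorm k0 g <= h0_sqnorm (@k_Matern R l nu D) g.
  by rewrite kE h0_sqnormD lerDl; exact: psd_matern_part.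
apply: rkhs_ball_dual.
- exact: k_Matern_sym.
- by move=> g _; exact: le_trans (k0_le g).
move=> g _; rewrite (_ : h0_pair _ g = A * h0_pair (k0 c) g); last first.
  by rewrite /h0_pair mulr_sumr; apply: eq_bigr => p _; ring.
rewrite exprMn; apply: (@le_trans _ _ (A ^+ 2 * (k0 c c * h0_sqnorm k0 g))).
  apply: ler_wpM2l; first exact: sqr_ge0.
  exact: (psd_cauchy_schwarz c g psd0 (@matern_part_sym _)).
have k0cc : 0 <= k0 c c.
  by have := psd0 [:: (1, c)]; rewrite /h0_sqnorm !big_seq1/= !mul1r.
by rewrite mulrA; apply: ler_pM => //; rewrite mulr_ge0 ?sqr_ge0.
Qed.

Lemma matern_family (Psi : R) : 0 < Psi -> exists2 C, 0 < C &
  exists2 a, 0 < a & forall n h, (0 < n)%N -> 0 < h -> h <= a * n%:R `^ (- nu) ->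
    hard_family (@k_Matern R l nu D) Psi C h n.
Proof.
move=> Psi0.
(* The factor 2 comes from squaring the Gaussian bound. *)
have [C1 C10 gridC] := grid_sum_bound (mulr_gt0 (ltr0n R 2) rho0).
have G0 := Gamma_gt0.
pose b := (Gamma_ nu)^-1 * expR (- nu - 1).
have b0 : 0 < b by rewrite mulr_gt0 ?invr_gt0 ?expR_gt0.
exists (4 * C1 ^+ D); first by rewrite mulr_gt0 ?exprn_gt0.
exists (Psi / 2 * Num.sqrt b); first by rewrite mulr_gt0 ?divr_gt0 ?sqrtr_gt0.
move=> n h n0 h0 hn; have nR0 : 0 < n%:R :> R by rewrite ltr0n.
pose theta : R := - (2 * ln n%:R).
have theta0 : theta <= 0.
  by rewrite oppr_le0 mulr_ge0// ln_ge0// ler1n.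
have etheta : expR (- theta) = n%:R ^+ 2.
  by rewrite /theta opprK mulrC expRM lnK ?posrE// powR_mulrn// ltW.
pose k0 := matern_part `]-oo, theta].
pose m0 := (Gamma_ nu)^-1 * \int[mu]_(t in `]-oo, theta]) mixture nu 0 t.
have k0cc c : k0 c c = m0 by rewrite /k0 /matern_part sqdistxx mulr0.
have m0b : b * (n%:R `^ (- nu)) ^+ 2 <= m0.
  rewrite /b -mulrA ler_wpM2l ?invr_ge0 ?(ltW G0)//.
  apply: le_trans (mixture_lower_bound theta0).
  rewrite -[in leLHS](lnK nR0) -expRM -expRM_natl -expRD ler_expR /theta.
  by rewrite le_eqVlt; apply/predU1P; left; ring.
have m00 : 0 < m0.
  by apply: lt_le_trans m0b; rewrite mulr_gt0// exprn_gt0// powR_gt0.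
pose A := 2 * h / m0.
pose center (m : {ffun 'I_D -> 'I_n}) : D.-tuple R :=
  [tuple (m i)%:R / n%:R | i < D].
exists (fun m x => A * k0 (center m) x); split.
- move=> m; apply: measurable_funM => //.
  (* Measurability by monotonicity in the squared distance; the maximum with 0 extends the function
     to all reals while keeping the mixture integrable. *)
  pose phi (r : R) := (Gamma_ nu)^-1 *
    \int[mu]_(t in `]-oo, theta]) mixture nu (rho * Num.max 0 r) t.
  have -> : k0 (center m) = phi \o sqdist (center m).
    apply/funext => x; rewrite /phi /= /k0 /matern_part max_r//.
    exact: sqdist_ge0.
  apply: measurableT_comp; last exact: measurable_sqdist.
  apply: nonincreasing_measurable; first exact: measurableT.
  move=> r r' rr.
  have max0 (z : R) : 0 <= rho * Num.max 0 z.
    by rewrite mulr_ge0 ?(ltW rho0)// le_max lexx.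
  rewrite ler_wpM2l ?invr_ge0 ?(ltW G0)//; apply: le_Rintegral => //.
  - exact: integrable_mixture_sub.
  - exact: integrable_mixture_sub.
  - move=> t _; apply: mixture_le; rewrite ler_pM2l//.
    by rewrite ge_max le_max lexx/= le_max rr orbT.
- move=> m; apply: matern_bump; rewrite -/k0 k0cc /A.
  have -> : (2 * h / m0) ^+ 2 * m0 = 4 * h ^+ 2 / m0 by field; rewrite gt_eqF.
  rewrite ler_pdivrMr//.
  apply: (@le_trans _ _ (Psi ^+ 2 * (b * (n%:R `^ (- nu)) ^+ 2))); last first.
    by rewrite ler_wpM2l// sqr_ge0.
  have -> : Psi ^+ 2 * (b * (n%:R `^ (- nu)) ^+ 2) =
      4 * (Psi / 2 * Num.sqrt b * n%:R `^ (- nu)) ^+ 2.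
    by rewrite !exprMn sqr_sqrtr ?ltW//; field.
  by rewrite ler_wpM2l// !expr2 ler_pM// ltW.
- move=> m; exists (center m).
    move=> i; rewrite tnth_mktuple divr_ge0//= ler_pdivrMr// mul1r ler_nat.
    exact: ltnW.
  by rewrite k0cc /A divfK// gt_eqF.
move=> x _.
pose G i (j : 'I_n) := expR (- (2 * rho * (n%:R * tnth x i - j%:R) ^+ 2)).
apply: (@le_trans _ _ (\sum_(m : {ffun 'I_D -> 'I_n})
    4 * h ^+ 2 * \prod_(i < D) G i (m i))).
  apply: ler_sum => m _.
  have /andP[] := matern_part_decay theta (center m) x.
  rewrite -/k0 k0cc; set E := expR _ => k0_ge0 k0E.
  have -> : \prod_(i < D) G i (m i) = E ^+ 2.
    rewrite -expR_sum -expRM_natl; congr expR.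
    rewrite etheta /sqdist mulrN !mulr_sumr -sumrN; apply: eq_bigr => i _.
    by rewrite tnth_mktuple; field; rewrite gt_eqF.
  rewrite (_ : 4 * h ^+ 2 * E ^+ 2 = (A * (m0 * E)) ^+ 2); last first.
    by rewrite /A; field; rewrite gt_eqF.
  have A0 : 0 < A by rewrite divr_gt0// mulr_gt0.
  have le_A : A * k0 (center m) x <= A * (m0 * E) by rewrite ler_pM2l.
  have A_ge0 : 0 <= A * k0 (center m) x by rewrite mulr_ge0// ltW.
  by rewrite !expr2 ler_pM.
rewrite -mulr_sumr -(bigA_distr_bigA G) mulrAC ler_wpM2r ?sqr_ge0//.
rewrite ler_wpM2l// -[leRHS](_ : \prod_(i < D) C1 = _); last first.
  by rewrite prodr_const card_ord.
apply: ler_prod => i _; apply/andP; split; last exact: gridC.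
by apply: sumr_ge0 => j _; exact: expR_ge0.
Qed.

End MaternFamily.

(** * Chebyshev interpolation and the squared exponential kernel *)

Section ChebyshevInterpolation.
Context {R : realType}.
Implicit Types (x t b : R) (n k m : nat).

Lemma sin_nat_pi p : sin (p%:R * pi) = 0 :> R.
Proof.
elim: p => [|p IHp]; first by rewrite mul0r sin0.
by rewrite -natr1 mulrDl mul1r sinDpi IHp oppr0.
Qed.

Lemma sin_odd_piB m t : sin (m.*2.+1%:R * pi - t) = sin t.
Proof.
elim: m => [|m IHm].
  by rewrite mul1r sinB sinpi cospi mul0r sub0r mulN1r opprK.
rewrite doubleS -natr1 -natr1 !mulrDl !mul1r.
rewrite (_ : _ + pi + pi - t = m.*2.+1%:R * pi - t + pi + pi); last by ring.
by rewrite !sinDpi opprK.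
Qed.

(** Each term times 2 sin b is sin ((2 m + 2) b) - sin (2 m b), and the sum telescopes. *)
Lemma sum_cos_odd n b :
  (\sum_(m < n) cos (m.*2.+1%:R * b)) * (2 * sin b) = sin (n.*2%:R * b).
Proof.
elim: n => [|n IHn]; first by rewrite big_ord0 !mul0r sin0.
rewrite big_ord_recr/= mulrDl IHn doubleS.
rewrite (_ : n.*2%:R * b = n.*2.+1%:R * b - b); last by rewrite -natr1; ring.
rewrite (_ : n.*2.+2%:R * b = n.*2.+1%:R * b + b); last by rewrite -[in LHS]natr1; ring.
by rewrite sinB sinD; ring.
Qed.

Lemma sum_cos_even n b :
  (\sum_(k < n) cos (k.*2%:R * b)) * (2 * sin b) =
  sin (n.*2%:R * b - b) + sin b.
Proof.
elim: n => [|n IHn]; first by rewrite big_ord0 !mul0r sub0r sinN addNr.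
rewrite big_ord_recr/= mulrDl IHn doubleS.
rewrite (_ : n.*2.+2%:R * b - b = n.*2%:R * b + b); last by rewrite -!natr1; ring.
by rewrite sinB sinD; ring.
Qed.

Definition cheb_node n m : R := m.*2.+1%:R * pi / n.*2%:R.

(** At b = p pi / (2 n) the telescoped sum is sin (p pi) = 0, while sin b > 0. *)
Lemma sum_cos_node n p : (0 < p < n.*2)%N ->
  \sum_(m < n) cos (p%:R * cheb_node n m) = 0.
Proof.
move=> /andP[p0 pn]; have n0 : 0 < n.*2%:R :> R.
  by rewrite ltr0n (leq_ltn_trans _ pn).
pose b : R := p%:R * pi / n.*2%:R.
have sb : 0 < sin b.
  apply: sin_gt0_pi; apply/andP; split.
    by rewrite divr_gt0// mulr_gt0 ?ltr0n ?pi_gt0.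
  by rewrite ltr_pdivrMr// mulrC ltr_pM2l ?pi_gt0// ltr_nat.
have := sum_cos_odd n b.
rewrite (_ : n.*2%:R * b = p%:R * pi); last by rewrite /b; field; rewrite gt_eqF.
rewrite sin_nat_pi => /eqP; rewrite mulf_eq0 mulf_eq0 pnatr_eq0 (gt_eqF sb) !orbF.
move=> /eqP sum0; rewrite -[RHS]sum0; apply: eq_bigr => m _; congr cos.
by rewrite /cheb_node /b; ring.
Qed.

(** Normalisation: over the nodes the constant cosine has twice the squared norm of the others. *)
Definition cheb_weight k : R := if k is 0 then 1 else 2.

(** A product of cosines splits into frequencies k + k' and k - k', both below 2 n in absolute
    value. *)
Lemma cheb_orthogonal n (k k' : 'I_n) :
  \sum_(m < n) cos (k%:R * cheb_node n m) * cos (k'%:R * cheb_node n m) =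
  if k == k' then n%:R / cheb_weight k else 0.
Proof.
have prodE (a c t : R) : cos (a * t) * cos (c * t) =
    2^-1 * (cos ((a + c) * t) + cos ((a - c) * t)).
  by rewrite mulrDl mulrBl cosD cosB; field.
under eq_bigr do rewrite prodE.
rewrite -mulr_sumr big_split/=.
have sumD : \sum_(m < n) cos ((k%:R + k'%:R) * cheb_node n m) =
    if (k + k' == 0)%N then n%:R else 0.
  rewrite -natrD; case: eqVneq => [->|kk'].
    under eq_bigr do rewrite mul0r cos0.
    by rewrite sumr_const card_ord.
  rewrite sum_cos_node// lt0n kk'/= -addnn.
  by rewrite -addSn leq_add// ltnW.
have sumB : \sum_(m < n) cos ((k%:R - k'%:R) * cheb_node n m) =
    if k == k' then n%:R else 0.
  have H (i j : 'I_n) : (i < j)%N ->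
      \sum_(m < n) cos ((j%:R - i%:R) * cheb_node n m) = 0 :> R.
    move=> ij; rewrite -natrB 1?ltnW// sum_cos_node// subn_gt0 ij/=.
    apply: leq_ltn_trans (leq_subr _ _) _; apply: leq_trans (ltn_ord j) _.
    by rewrite -addnn leq_addr.
  case: eqVneq => [->|].
    under eq_bigr do rewrite subrr mul0r cos0.
    by rewrite sumr_const card_ord.
  rewrite -val_eqE/= neq_ltn => /orP[]; last exact: H.
  move=> /H H0; rewrite -[RHS]H0; apply: eq_bigr => m _.
  by rewrite -cosN -mulNr opprB.
rewrite sumD sumB; have [->|kk'] := eqVneq k k'; last first.
  rewrite addn_eq0 ifF ?addr0 ?mulr0//.
  apply/negP => /andP[/eqP k0 /eqP k0'].
  by move/negP: kk'; apply; rewrite -val_eqE/= k0 k0'.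
rewrite addnn double_eq0 /cheb_weight; case: (nat_of_ord k') => [|j]/=.
  by field.
by rewrite add0r mulrC.
Qed.

(* The Lagrange basis at the Chebyshev nodes, as a function of the angle. *)
Definition cheb_lagrange n m t : R :=
  n%:R^-1 * \sum_(k < n) cheb_weight k * cos (k%:R * cheb_node n m) * cos (k%:R * t).

Lemma cheb_weight_gt0 k : 0 < cheb_weight k.
Proof. by case: k. Qed.

Lemma cheb_weight_le2 k : cheb_weight k <= 2.
Proof. by case: k => //=; rewrite ler1n. Qed.

(** Discrete orthogonality removes the cross terms and leaves the mean over k of [cheb_weight k]
    times cos^2 (k t), a bound free of [n]. *)
Lemma sum_cheb_lagrange_sqr n t : (0 < n)%N ->
  \sum_(m < n) cheb_lagrange n m t ^+ 2 <= 2.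
Proof.
move=> n0; have nR : 0 < n%:R :> R by rewrite ltr0n.
pose a k := cheb_weight k * cos (k%:R * t).
rewrite (_ : \sum_(m < n) _ = n%:R^-1 ^+ 2 * \sum_(m < n)
    (\sum_(k < n) a k * cos (k%:R * cheb_node n m)) ^+ 2); last first.
  rewrite mulr_sumr; apply: eq_bigr => m _; rewrite -exprMn; congr (_ ^+ 2).
  by congr (_ * _); apply: eq_bigr => k _; rewrite /a; ring.
rewrite (_ : \sum_(m < n) _ = \sum_(k < n) a k ^+ 2 * (n%:R / cheb_weight k)).
  rewrite (_ : _ * _ = n%:R^-1 * \sum_(k < n) cheb_weight k * cos (k%:R * t) ^+ 2).
    rewrite ler_pdivrMl//.
    apply: (@le_trans _ _ (\sum_(k < n) 2)); last first.
      by rewrite sumr_const card_ord mulr_natl.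
    apply: ler_sum => k _.
    have c3 : cos (k%:R * t) ^+ 2 <= 1 by rewrite cos2sin2 gerBl sqr_ge0.
    rewrite -[leRHS]mulr1 ler_pM//; last exact: cheb_weight_le2.
    - exact: ltW (cheb_weight_gt0 _).
    - exact: sqr_ge0.
  rewrite expr2 -mulrA; congr (_ * _); rewrite mulr_sumr.
  apply: eq_bigr => k _; rewrite /a; field.
  by rewrite !gt_eqF// cheb_weight_gt0.
under eq_bigr => m _ do rewrite expr2 mulr_suml.
rewrite exchange_big/=; apply: eq_bigr => k _.
under eq_bigr => m _ do rewrite mulr_sumr.
rewrite exchange_big/= (bigD1 k)//= [X in _ + X]big1 ?addr0 => [|k' k'k].
  under eq_bigr => m _ do rewrite mulrACA -expr2.
  by rewrite -mulr_sumr cheb_orthogonal eqxx.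
under eq_bigr => m _ do rewrite mulrACA.
by rewrite -mulr_sumr cheb_orthogonal eq_sym (negbTE k'k) mulr0.
Qed.

(** Each term is 1 + cos (2 k g), less 1 at k = 0; the cosines sum to 1, which cancels that
    correction. *)
Lemma cheb_lagrange_node n (m : 'I_n) : cheb_lagrange n m (cheb_node n m) = 1.
Proof.
have nR : 0 < n%:R :> R by rewrite ltr0n (leq_ltn_trans _ (ltn_ord m)).
have n2R : 0 < n.*2%:R :> R.
  by rewrite ltr0n double_gt0 (leq_ltn_trans _ (ltn_ord m)).
pose g : R := cheb_node n m.
have sg : 0 < sin g.
  apply: sin_gt0_pi; apply/andP; split.
    by rewrite divr_gt0// mulr_gt0 ?ltr0n ?pi_gt0.
  rewrite ltr_pdivrMr// mulrC ltr_pM2l ?pi_gt0// ltr_nat.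
  by rewrite ltn_Sdouble.
have sumE : \sum_(k < n) cos (k.*2%:R * g) = 1.
  have := sum_cos_even n g.
  rewrite (_ : n.*2%:R * g = m.*2.+1%:R * pi); last first.
    by rewrite /g /cheb_node; field; rewrite gt_eqF.
  rewrite sin_odd_piB => H; apply: (mulIf (x := 2 * sin g)).
    by rewrite mulf_neq0// gt_eqF.
  by rewrite H mul1r mulrDl mul1r.
have wE (k : 'I_n) : cheb_weight k * cos (k%:R * g) * cos (k%:R * g) =
    1 + cos (k.*2%:R * g) - (k == 0%N :> nat)%:R.
  have -> : k.*2%:R * g = (k%:R * g) *+ 2 by rewrite -muln2 natrM; ring.
  rewrite cos_mulr2n.
  case: (nat_of_ord k) => [|j] /=; first by rewrite mul0r cos0; ring.
  by ring.
rewrite /cheb_lagrange -/g; under eq_bigr do rewrite wE.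
rewrite sumrB big_split/= sumE sumr_const card_ord.
rewrite (_ : \sum_(k < n) _ = 1); first by field; rewrite gt_eqF.
have n0 : (0 < n)%N by rewrite -(ltr0n R).
rewrite (bigD1 (Ordinal n0))//= big1 ?addr0// => k.
by rewrite -val_eqE/= => /negbTE ->.
Qed.

End ChebyshevInterpolation.

(** * Coefficients of Chebyshev polynomials *)

Section CoefficientNorm.
Context {R : realType} (N : nat).
Implicit Types p q : {poly R}.

Definition coef_norm p : R := \sum_(i < N) `|p`_i|.

Lemma coef_norm_ge0 p : 0 <= coef_norm p.
Proof. exact: sumr_ge0. Qed.

Lemma coef_normD p q : coef_norm (p + q) <= coef_norm p + coef_norm q.
Proof. by rewrite -big_split ler_sum// => i _; rewrite coefD ler_normD. Qed.

Lemma coef_normZ c p : coef_norm (c *: p) = `|c| * coef_norm p.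
Proof. by rewrite mulr_sumr; apply: eq_bigr => i _; rewrite coefZ normrM. Qed.

Lemma coef_normN p : coef_norm (- p) = coef_norm p.
Proof. by apply: eq_bigr => i _; rewrite coefN normrN. Qed.

Lemma coef_normMX p : coef_norm ('X * p) <= coef_norm p.
Proof.
rewrite /coef_norm; case: N => [|M]; first by rewrite !big_ord0.
rewrite big_ord_recl [leRHS]big_ord_recr/= coefXM eqxx normr0 add0r.
rewrite -[leLHS]addr0 lerD// ler_sum// => i _.
by rewrite coefXM.
Qed.

Lemma coef_norm1 : coef_norm 1 <= 1.
Proof.
rewrite /coef_norm; case: N => [|M]; first by rewrite big_ord0.
rewrite big_ord_recl big1 ?addr0 => [|i _]; first by rewrite coef1 normr1.
by rewrite coef1 normr0.
Qed.

Lemma coef_norm_sum (I : Type) (s : seq I) (F : I -> {poly R}) :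
  coef_norm (\sum_(i <- s) F i) <= \sum_(i <- s) coef_norm (F i).
Proof.
elim: s => [|i s IHs].
  by rewrite !big_nil /coef_norm big1// => i _; rewrite coef0 normr0.
by rewrite !big_cons; apply: le_trans (coef_normD _ _) _; rewrite lerD2l.
Qed.

End CoefficientNorm.

Section ChebyshevPolynomial.
Context {R : realType} (s1 s0 : R).

(* The pair (T_k, T_(k+1)) of Chebyshev polynomials of s1 X - s0. *)
Fixpoint cheb2 k : {poly R} * {poly R} :=
  if k is k'.+1 then
    let: (p, q) := cheb2 k' in (q, 2%:P * ((s1 *: 'X - s0%:P) * q) - p)
  else (1, s1 *: 'X - s0%:P).

Definition cheb k := (cheb2 k).1.

Lemma chebSS k :
  cheb k.+2 = 2%:P * ((s1 *: 'X - s0%:P) * cheb k.+1) - cheb k.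
Proof. by rewrite /cheb /=; case: (cheb2 k). Qed.

Lemma cheb0 : cheb 0 = 1. Proof. by []. Qed.

Lemma cheb1 : cheb 1 = s1 *: 'X - s0%:P. Proof. by []. Qed.

Lemma cheb_ind (Q : nat -> Prop) : Q 0%N -> Q 1%N ->
  (forall k, Q k -> Q k.+1 -> Q k.+2) -> forall k, Q k.
Proof.
move=> Q0 Q1 QS k; suff [] : Q k /\ Q k.+1 by [].
by elim: k => // k [? ?]; split => //; exact: QS.
Qed.

Lemma size_affine : (size (s1 *: 'X - s0%:P)%R <= 2)%N.
Proof.
rewrite (leq_trans (size_polyD _ _))// geq_max size_polyN.
rewrite (leq_trans (size_scale_leq _ _)) ?size_polyX//=.
by rewrite (leq_trans (size_polyC_leq1 _)).
Qed.

Lemma size_cheb k : (size (cheb k) <= k.+1)%N.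
Proof.
elim/cheb_ind: k => [||k IH0 IH1]; first by rewrite cheb0 size_poly1.
  by rewrite cheb1 size_affine.
rewrite chebSS (leq_trans (size_polyD _ _))// geq_max size_polyN.
apply/andP; split; last by rewrite (leq_trans IH0)// ltnW.
rewrite mul_polyC (leq_trans (size_scale_leq _ _))//.
rewrite (leq_trans (size_polyMleq _ _))//.
by have := leq_add size_affine IH1; lia.
Qed.

Lemma horner_cheb k u t : s1 * u - s0 = cos t ->
  (cheb k).[u] = cos (k%:R * t).
Proof.
move=> ut; elim/cheb_ind: k => [||k IH0 IH1].
- by rewrite cheb0 hornerC mul0r cos0.
- by rewrite cheb1 !hornerE ut.
rewrite chebSS !(hornerD, hornerN, hornerM, hornerZ, hornerX, hornerC).
rewrite IH0 IH1 ut.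
rewrite (_ : k.+2%:R * t = k.+1%:R * t + t); last by rewrite -natr1; ring.
rewrite (_ : k%:R * t = k.+1%:R * t - t); last by rewrite -natr1; ring.
by rewrite cosB cosD; ring.
Qed.

(** The recurrence gives c_(k+2) <= 2 A c_(k+1) + c_k; for A >= 1 growth by 3 A per step absorbs
    both terms, as 6 + 1 <= 9. *)
Lemma coef_norm_cheb N k A : 1 <= A -> `|s1| + `|s0| <= A ->
  coef_norm N (cheb k) <= (3 * A) ^+ k.
Proof.
move=> A1 sA; have A0 : 0 <= A by rewrite (le_trans ler01).
have affM p : coef_norm N ((s1 *: 'X - s0%:P) * p) <= A * coef_norm N p.
  rewrite mulrBl -scalerAl mul_polyC.
  apply: le_trans (coef_normD _ _ _) _; rewrite coef_normN !coef_normZ.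
  apply: le_trans _ (ler_wpM2r (coef_norm_ge0 _ _) sA).
  by rewrite mulrDl lerD2r ler_wpM2l// coef_normMX.
elim/cheb_ind: k => [||k IH0 IH1]; first by rewrite cheb0 expr0 coef_norm1.
  rewrite cheb1 -[_ - _]mulr1 expr1; apply: le_trans (affM _) _.
  apply: (@le_trans _ _ (A * 1)); first by rewrite ler_wpM2l// coef_norm1.
  by lra.
rewrite chebSS; apply: le_trans (coef_normD _ _ _) _.
rewrite coef_normN mul_polyC coef_normZ ger0_norm//.
have IH1' : A * coef_norm N (cheb k.+1) <= A * (3 * A) ^+ k.+1.
  by rewrite ler_wpM2l.
have := affM (cheb k.+1); move: IH0 IH1'; rewrite !exprS.
set x := (3 * A) ^+ k => h0 h1 h2.
have x0 : 0 <= x by rewrite exprn_ge0// mulr_ge0.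
have AA : 1 <= A * A by rewrite -[leLHS]mulr1 ler_pM.
have := ler_wpM2r x0 AA; rewrite mul1r.
move: h0 h1 h2; set a := coef_norm _ _; set b := coef_norm _ _.
set c := coef_norm _ _.
rewrite (_ : A * (3 * A * x) = 3 * (A * A * x)); last by ring.
rewrite (_ : 3 * A * (3 * A * x) = 9 * (A * A * x)); last by ring.
by move: (A * A * x) (A * b) => y z; lra.
Qed.

End ChebyshevPolynomial.

Lemma rkhs_ball_finite {R : realType} (P : eqType) (k : P -> P -> R)
    (D : set P) (Psi : R) (g : seq (R * P)) (f : P -> R) :
  (forall p, p \in g -> D p.2) ->
  (forall x, D x -> h0_eval k g x = f x) -> h0_sqnorm k g <= Psi ^+ 2 ->
  rkhs_ball k D Psi f.
Proof.
move=> Dg gf gPsi; exists (fun=> g); split => //.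
- move=> e e0; exists 0%N => _ _ _ _.
  rewrite (_ : h0_sqnorm _ _ = 0)//.
  rewrite -[LHS]/(h0_dot k (h0_sub g g) (h0_sub g g)) h0_subE h0_dot_catl.
  by rewrite h0_dot_scalel mulN1r subrr.
- by move=> x Dx; rewrite gf//; exact: cvg_cst.
- by exists (h0_sqnorm k g); split => //; exact: cvg_cst.
Qed.

Lemma h0_sqnorm_le_l1 {R : realType} (P : Type) (k : P -> P -> R) g :
  (forall x y, `|k x y| <= 1) ->
  h0_sqnorm k g <= (\sum_(p <- g) `|p.1|) ^+ 2.
Proof.
move=> k1; rewrite expr2 mulr_suml; apply: ler_sum => p _.
rewrite mulr_sumr; apply: ler_sum => q _.
apply: le_trans (ler_norm _) _; rewrite !normrM -[leRHS]mulr1.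
by rewrite ler_wpM2l// mulr_ge0.
Qed.

(** * Bumps for the squared exponential kernel *)

Section GaussianFamily.
Context {R : realType} (D : nat).
Variable l : R.
Hypothesis l0 : 0 < l.

Let c2 := (2 * l ^+ 2)^-1.

Let c2_gt0 : 0 < c2.
Proof. by rewrite invr_gt0 mulr_gt0// exprn_gt0. Qed.

Section Univariate.
Variable n : nat.
Hypothesis n0 : (0 < n)%N.

Let nR : 0 < n%:R :> R. Proof. by rewrite ltr0n. Qed.

(* e^{-(x - j/n)^2 / 2l^2} = e^{-x^2 / 2l^2} u^j e^{-(j/n)^2 / 2l^2} with
   u = e^{x / (n l^2)}, so that a combination of n translates of the kernel is
   a Gaussian times a polynomial in u. *)
Let u x := expR (2 * c2 * x / n%:R).
Let U := expR (2 * c2 / n%:R).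

Let U_gt1 : 1 < U.
Proof. by rewrite expR_gt1 divr_gt0// mulr_gt0. Qed.

Let U1 : 0 < U - 1. Proof. by rewrite subr_gt0. Qed.

(** The map v -> s1 v - s0 sends [1, U], the range of [u] on [0, 1], onto [-1, 1]. As U - 1 >= 2 c2
    / n, its coefficients are O(n). *)
Let s1 := 2 / (U - 1).
Let s0 := (1 + U) / (U - 1).

Let A := n%:R * ((3 + expR (2 * c2)) / (2 * c2)).

Let s_le_A : `|s1| + `|s0| <= A.
Proof.
have U0 : 0 < U by exact: expR_gt0.
have s1_ge0 : 0 <= s1 by apply: divr_ge0 => //; exact: ltW.
have s0_ge0 : 0 <= s0.
  by apply: divr_ge0; [rewrite addr_ge0// ltW|exact: ltW].
rewrite !ger0_norm//.
rewrite /s1 /s0 -mulrDl addrA (_ : 2 + 1 = 3 :> R); last by ring.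
rewrite ler_pdivrMr//.
have U2 : U <= expR (2 * c2).
  rewrite ler_expR ler_pdivrMr// ler_peMr ?ler1n//.
  by rewrite mulr_ge0// ltW.
have dU : 2 * c2 / n%:R <= U - 1 by rewrite lerBrDl expR_ge1Dx.
have A0 : 0 <= A.
  rewrite /A mulr_ge0//; apply: divr_ge0; last by rewrite mulr_ge0// ltW.
  by rewrite addr_ge0 ?expR_ge0.
apply: le_trans (ler_wpM2l A0 dU); rewrite /A.
rewrite (_ : _ * (_ / _) * _ = 3 + expR (2 * c2)) ?lerD2l//.
by field; rewrite !gt_eqF// mulr_gt0.
Qed.

Let A_ge1 : 1 <= A.
Proof.
apply: le_trans s_le_A; apply: (@le_trans _ _ `|s0|); last by rewrite lerDr.
apply: le_trans (ler_norm _); rewrite ler_pdivlMr// mul1r.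
by move: (U) => v; lra.
Qed.

Definition se_poly m : {poly R} := n%:R^-1 *:
  \sum_(k < n) (cheb_weight k * cos (k%:R * cheb_node n m)) *: cheb s1 s0 k.

(** The exponential cancels the factor that depends only on the centre j / n of the translate. *)
Definition se_coef m j : R := (se_poly m)`_j * expR (c2 * (j%:R / n%:R) ^+ 2).

Definition se_bump m x : R :=
  \sum_(j < n) se_coef m j * expR (- (c2 * (j%:R / n%:R - x) ^+ 2)).

Lemma se_bumpE m x : se_bump m x = expR (- (c2 * x ^+ 2)) * (se_poly m).[u x].
Proof.
rewrite (@horner_coef_wide _ n) ?mulr_sumr; last first.
  rewrite (leq_trans (size_scale_leq _ _))//.
  apply: (leq_trans (size_sum _ _ _)); apply/bigmax_leqP => k _.
  rewrite (leq_trans (size_scale_leq _ _))//.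
  exact: leq_trans (size_cheb _ _ _) _.
apply: eq_bigr => j _; rewrite /se_coef /u -expRM_natl [RHS]mulrCA -[LHS]mulrA.
congr (_ * _); rewrite -!expRD; congr expR.
by field; rewrite gt_eqF.
Qed.

Lemma horner_se_poly m v t : s1 * v - s0 = cos t ->
  (se_poly m).[v] = cheb_lagrange n m t.
Proof.
move=> vt; rewrite hornerZ horner_sum /cheb_lagrange; congr (_ * _).
by apply: eq_bigr => k _; rewrite hornerZ (horner_cheb _ vt).
Qed.

Lemma sum_se_bump_sqr x : 0 <= x <= 1 -> \sum_(m < n) se_bump m x ^+ 2 <= 2.
Proof.
move=> /andP[x0 x1].
have u1 : 1 <= u x by rewrite -expR0 ler_expR divr_ge0// !mulr_ge0// ltW.
have uU : u x <= U.
  by rewrite ler_expR ler_wpM2r ?invr_ge0// ger_pMr ?mulr_gt0.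
have su : -1 <= s1 * u x - s0 <= 1.
  rewrite /s1 /s0 (_ : _ - _ = (2 * u x - (1 + U)) / (U - 1)); last first.
    by field; rewrite gt_eqF.
  by rewrite ler_pdivlMr// ler_pdivrMr//; apply/andP; split; lra.
have [_ tE] := acos_def su.
apply: le_trans (sum_cheb_lagrange_sqr (acos (s1 * u x - s0)) n0).
apply: ler_sum => m _; rewrite se_bumpE (horner_se_poly _ (esym tE)) exprMn.
rewrite ler_piMl ?sqr_ge0//.
suff e1 : expR (- (c2 * x ^+ 2)) <= 1 by rewrite exprn_ile1 ?expR_ge0.
by rewrite -expR0 ler_expR oppr_le0 mulr_ge0 ?sqr_ge0// ltW.
Qed.

(** The point that is mapped to the cosine of the node lies in [0, 1]; there the polynomial is 1 and
    only the Gaussian factor is lost. *)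
Lemma se_bump_peak (m : 'I_n) :
  exists2 x, 0 <= x <= 1 & expR (- c2) <= se_bump m x.
Proof.
pose v := ((U - 1) * cos (cheb_node n m) + (1 + U)) / 2.
have v1 : 1 <= v.
  have := ler_wpM2l (ltW U1) (cos_geN1 (cheb_node n m : R)).
  by rewrite /v; lra.
have vU : v <= U.
  have := ler_wpM2l (ltW U1) (cos_le1 (cheb_node n m : R)).
  by rewrite /v; lra.
have v0 : 0 < v by rewrite (lt_le_trans ltr01).
pose x := ln v * n%:R / (2 * c2).
have ux : u x = v.
  rewrite /u (_ : _ / n%:R = ln v) ?lnK//.
  by rewrite /x; field; rewrite !gt_eqF.
have x0 : 0 <= x by rewrite !mulr_ge0 ?ln_ge0// invr_ge0 mulr_ge0// ltW.
have x1 : x <= 1.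
  rewrite ler_pdivrMr ?mulr_gt0// mul1r -ler_pdivlMr//.
  by rewrite -ler_expR lnK.
exists x; first by rewrite x0.
rewrite se_bumpE (@horner_se_poly _ _ (cheb_node n m)).
  rewrite cheb_lagrange_node mulr1 ler_expR lerN2 ger_pMr//.
  by rewrite expr_le1.
by rewrite ux /s1 /s0 /v; field; rewrite gt_eqF.
Qed.

Lemma sum_se_coef m :
  \sum_(j < n) `|se_coef m j| <= 2 * expR c2 * (3 * A) ^+ n.
Proof.
have A0 : 0 <= A by rewrite (le_trans ler01).
have A3 : 1 <= 3 * A by move: A_ge1; lra.
apply: (@le_trans _ _ (expR c2 * coef_norm n (se_poly m))).
  rewrite mulr_sumr; apply: ler_sum => j _; rewrite normrM mulrC.
  rewrite ler_wpM2r// ger0_norm ?expR_ge0// ler_expR ger_pMr//.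
  rewrite expr_le1 ?divr_ge0// ler_pdivrMr// mul1r ler_nat.
  exact: ltnW.
rewrite mulrAC mulrC ler_wpM2r ?expR_ge0// coef_normZ ger0_norm ?invr_ge0//.
rewrite ler_pdivrMl//; apply: le_trans (coef_norm_sum _ _ _) _.
apply: (@le_trans _ _ (\sum_(k < n) 2 * (3 * A) ^+ n)); last first.
  by rewrite sumr_const card_ord -[leLHS]mulr_natl.
apply: ler_sum => k _; rewrite coef_normZ; apply: ler_pM => //.
- exact: coef_norm_ge0.
- rewrite normrM -[leRHS]mulr1; apply: ler_pM => //.
    by rewrite ger0_norm ?cheb_weight_le2// ltW// cheb_weight_gt0.
  by rewrite ler_norml cos_geN1 cos_le1.
- apply: le_trans (coef_norm_cheb _ _ A_ge1 s_le_A) _.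
  by rewrite ler_weXn2l// ltnW.
Qed.

End Univariate.

Lemma k_SE_prod (x y : D.-tuple R) :
  k_SE l x y = \prod_(i < D) expR (- (c2 * (tnth x i - tnth y i) ^+ 2)).
Proof.
rewrite -expR_sum /k_SE; congr expR; rewrite -/c2 mulrC mulrN /sqdist mulr_sumr.
by rewrite sumrN.
Qed.

Lemma k_SE_le1 (x y : D.-tuple R) : `|k_SE l x y| <= 1.
Proof.
rewrite ger0_norm ?expR_ge0// expR_le1 mulNr oppr_le0.
by rewrite mulr_ge0 ?sqdist_ge0// ltW.
Qed.

Lemma measurable_se_bump n m : measurable_fun setT (se_bump n m).
Proof.
apply: measurable_sum => j; apply: measurable_funM => //.
apply: measurableT_comp => //; apply: measurableT_comp => //.
apply: measurable_funM => //; apply: measurable_funX.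
exact: measurable_funB.
Qed.

(** Tensor products of univariate bumps: peaks multiply, and sums over multi-indices factor into [D]
    univariate sums. Each bump is a finite combination of kernel sections, with norm at most the sum
    of its absolute coefficients. *)
Lemma gaussian_family (Psi : R) : 0 < Psi -> exists2 C, 0 < C &
  exists2 a, 0 < a & exists2 K, 0 < K &
  forall n h, (0 < n)%N -> 0 < h -> h <= a * expR (- (K * n%:R ^+ 2)) ->
    hard_family (@k_SE R l D) Psi C h n.
Proof.
(* [e2] restores the height 2 h after the loss of a factor e^(- c2) per coordinate at the peak. *)
move=> Psi0; pose e2 := 2 * expR (D%:R * c2).
have e20 : 0 < e2 by rewrite mulr_gt0// expR_gt0.
pose A1 := 3 * ((3 + expR (2 * c2)) / (2 * c2)).
have A10 : 0 < A1.
  by rewrite mulr_gt0// divr_gt0 ?mulr_gt0// addr_gt0// expR_gt0.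
have ec0 : 0 < 2 * expR c2 by rewrite mulr_gt0// expR_gt0.
exists (e2 ^+ 2 * 2 ^+ D); first by rewrite mulr_gt0// exprn_gt0.
exists (Psi / (e2 * (2 * expR c2) ^+ D)).
  by rewrite divr_gt0// mulr_gt0// exprn_gt0.
exists (D%:R * A1 + 1).
  by rewrite ltr_wpDl// mulr_ge0// ltW.
move=> n h n0 h0 hn; have nR0 : 0 < n%:R :> R by rewrite ltr0n.
pose A := e2 * h.
have A0 : 0 < A by rewrite mulr_gt0.
pose node (j : {ffun 'I_D -> 'I_n}) : D.-tuple R :=
  [tuple (j i)%:R / n%:R | i < D].
pose coef (m j : {ffun 'I_D -> 'I_n}) : R := \prod_(i < D) se_coef n (m i) (j i).
pose g m := [seq (A * coef m j, node j) | j : {ffun 'I_D -> 'I_n}].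
pose f (m : {ffun 'I_D -> 'I_n}) (x : D.-tuple R) :=
  A * \prod_(i < D) se_bump n (m i) (tnth x i).
have gf m x : h0_eval (@k_SE R l D) (g m) x = f m x.
  rewrite /h0_eval /g big_image/= /f /se_bump bigA_distr_bigA mulr_sumr.
  apply: eq_bigr => j _; rewrite big_split/= mulrA k_SE_prod; congr (_ * _).
  by apply: eq_bigr => i _; rewrite tnth_mktuple.
exists f; split.
- move=> m; apply: measurable_funM => //; apply: measurable_prod => i _.
  apply: measurableT_comp; first exact: measurable_se_bump.
  exact: measurable_tnth.
- move=> m; apply: (@rkhs_ball_finite _ _ _ _ _ (g m)).
  + move=> p /mapP[j _ ->] i /=; rewrite tnth_mktuple divr_ge0//=.
    by rewrite ler_pdivrMr// mul1r ler_nat ltnW.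
  + by move=> x _; exact: gf.
  + apply: le_trans (h0_sqnorm_le_l1 _ k_SE_le1) _.
    suff gP : \sum_(p <- g m) `|p.1| <= Psi.
      by rewrite !expr2 ler_pM// ?sumr_ge0.
    rewrite /g big_image/=.
    under eq_bigr do rewrite normrM normr_prod.
    rewrite -mulr_sumr.
    rewrite -(bigA_distr_bigA (fun i (j : 'I_n) => `|se_coef n (m i) j|)).
    apply: (@le_trans _ _ (A * (2 * expR c2 * expR (A1 * n%:R ^+ 2)) ^+ D)).
      rewrite ger0_norm ?(ltW A0)// ler_pM2l//.
      rewrite -[leRHS](_ : \prod_(i < D) (2 * expR c2 * expR (A1 * n%:R ^+ 2)) = _);
        last first.
        by rewrite prodr_const card_ord.
      apply: ler_prod => i _; apply/andP; split; first exact: sumr_ge0.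
      apply: le_trans (sum_se_coef n0 _) _; rewrite ler_pM2l//.
      (* The crude bound x <= e^x turns (A1 n)^n into e^(A1 n^2), the source of the exponent K
         n^2. *)
      rewrite (_ : A1 * _ = n%:R * (A1 * n%:R)); last by ring.
      rewrite expRM_natl lerXn2r ?nnegrE ?expR_ge0//.
        by rewrite !mulr_ge0// ?invr_ge0 ?mulr_ge0// ?addr_ge0 ?expR_ge0// ltW.
      apply: (@le_trans _ _ (A1 * n%:R)); first by rewrite /A1; lra.
      by apply: le_trans (expR_ge1Dx _); rewrite lerDr.
    rewrite exprMn -expRM_natl /A.
    set E := expR (_ * _); set F := _ ^+ D.
    have F0 : 0 < F by rewrite exprn_gt0.
    rewrite (_ : e2 * h * _ = e2 * F * (h * E)); last by ring.
    rewrite -ler_pdivlMl; last exact: mulr_gt0.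
    rewrite [leRHS]mulrC -ler_pdivlMr ?expR_gt0// (le_trans hn)// -expRN.
    rewrite ler_pM2l; last by apply: divr_gt0 => //; exact: mulr_gt0.
    by rewrite ler_expR; have := sqr_ge0 (n%:R : R); lra.
- move=> m.
  have peak i : exists x : R, 0 <= x <= 1 /\ expR (- c2) <= se_bump n (m i) x.
    by have [x x01 xE] := se_bump_peak n0 (m i); exists x.
  have /choice[x xP] := peak.
  exists [tuple x i | i < D].
    by move=> i; rewrite tnth_mktuple; have [] := xP i.
  apply: (@le_trans _ _ (A * \prod_(i < D) expR (- c2))).
    rewrite prodr_const card_ord -expRM_natl /A /e2 mulrN.
    by rewrite expRN; have := expR_gt0 (D%:R * c2); move: (expR _) => v v0;
      rewrite (_ : _ / v = 2 * h) //; field; rewrite gt_eqF.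
  rewrite ler_pM2l//; apply: ler_prod => i _.
  by rewrite tnth_mktuple expR_ge0; have [] := xP i.
move=> x xc.
rewrite (_ : \sum_m _ = A ^+ 2 * \prod_(i < D) \sum_(j < n) se_bump n j (tnth x i) ^+ 2).
  rewrite /A exprMn [leRHS]mulrAC ler_pM2l; last first.
    by apply: mulr_gt0; exact: exprn_gt0.
  rewrite -[leRHS](_ : \prod_(i < D) 2 = _); last first.
    by rewrite prodr_const card_ord.
  apply: ler_prod => i _; rewrite sumr_ge0 => [/=|j _]; last exact: sqr_ge0.
  exact: sum_se_bump_sqr.
rewrite bigA_distr_bigA mulr_sumr; apply: eq_bigr => m _.
by rewrite /f exprMn prodrXl.
Qed.

End GaussianFamily.

(** * Choice of the batch *)

(** The batch, [n], [h] and [C] may depend on the batch lengths; the constant [c] and [T0] may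
    not. *)
Lemma batch_lower_bound_family {R : realType} (D B : nat)
    (k : D.-tuple R -> D.-tuple R -> R) (Psi sig : R) (rate : nat -> R) :
  0 < sig ->
  (exists2 c, 0 < c & exists T0, forall T, (T0 <= T)%N ->
    forall N : 'I_B -> nat, (\sum_(b < B) N b)%N = T ->
    exists (j : 'I_B) n h C, [/\ hard_family k Psi C h n, (0 < n)%N, 0 < h,
      8 * (2 * C + 528 * C * (psum N j)%:R * h ^+ 2 / sig ^+ 2) <= n%:R ^+ D
    & c * rate T <= h * (N j)%:R / 2]) ->
  batch_lower_bound B k Psi sig rate.
Proof.
move=> sig0 [c c0 [T0 cT]]; exists c; split => //; exists T0 => T TT0.
move=> d O P Z eps mZ meps epsE indep N sumN pi mpi pi_cube.
have [j [n [h [C [[f [mf fPsi fc fC]] n0 h0 nC cN]]]]] := cT _ TT0 _ sumN.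
have cardI : #|{: {ffun 'I_D -> 'I_n}}| = (n ^ D)%N by rewrite card_ffun !card_ord.
have I0 : (0 < #|{: {ffun 'I_D -> 'I_n}}|)%N by rewrite cardI expn_gt0 n0.
have nC' : 8 * (2 * C + 528 * C * (psum N j)%:R * h ^+ 2 / sig ^+ 2) <=
    #|{: {ffun 'I_D -> 'I_n}}|%:R by rewrite cardI natrX.
have [m Pm] := exists_hard_instance sumN mpi pi_cube sig0 mZ meps epsE indep
  I0 h0 mf fc fC nC'.
exists (f m); split => //; apply: (le_trans Pm); apply: le_measure; rewrite ?inE.
- rewrite -[X in measurable X]setTI; apply: measurable_fun_le => //.
  exact: measurable_regret.
- rewrite -[X in measurable X]setTI; apply: measurable_fun_le => //.
  exact: measurable_regret.
- by move=> w /=; exact: le_trans.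
Qed.

Section CriticalBatch.
Context {R : realType}.
Variables (B : nat) (eta : R).
Hypotheses (B0 : (0 < B)%N) (eta0 : 0 < eta) (eta1 : eta < 1).

Definition rate_exponent : R := (1 - eta) / (1 - eta ^+ B).

Let etaB : 0 < 1 - eta ^+ B.
Proof. by rewrite subr_gt0 exprn_ilt1// -?lt0n// ltW. Qed.

Lemma rate_exponent_gt0 : 0 < rate_exponent.
Proof. by rewrite divr_gt0// subr_gt0. Qed.

Let e (j : nat) : R := (1 - eta ^+ j) / (1 - eta ^+ B).

(* The thresholds mu X^(e j) solve e (j + 1) = alpha + eta e j with e 0 = 0 and
   e B = 1, which makes every batch equally costly. *)
Lemma critical_batch (N : 'I_B -> nat) (mu X : R) :
  0 <= mu -> 1 <= X -> 2 <= X `^ (rate_exponent * eta ^+ B) ->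
  mu * X <= (\sum_(b < B) N b)%:R ->
  exists (j : 'I_B) q, [/\ 1 <= q, (psum N j)%:R <= mu * q,
    mu * X `^ rate_exponent * q `^ eta / 2 <= (N j)%:R
  & psum N j = 0%N \/ X `^ rate_exponent <= q].
Proof.
move=> mu0 X1 X2 NX; have X0 : 0 < X by rewrite (lt_le_trans ltr01).
have XN0 : X != 0 by rewrite gt_eqF.
have alpha0 := rate_exponent_gt0.
have eS j : e j.+1 = rate_exponent + eta * e j.
  by rewrite /e /rate_exponent exprS; field; rewrite gt_eqF.
have e_ge0 j : 0 <= e j.
  by rewrite divr_ge0 ?(ltW etaB)// subr_ge0 exprn_ile1// ltW.
have ex : exists b, (b <= B)%N && (mu * X `^ e b <= (psum N b)%:R).
  exists B; rewrite leqnn/= /e divff ?gt_eqF// powRr1 ?(ltW X0)//.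
  apply: le_trans NX _; rewrite ler_nat /psum.
  by under [leqRHS]eq_bigl do rewrite ltn_ord.
have psum0 : psum N 0 = 0%N by rewrite /psum big1// => i; rewrite ltn0.
(* The first batch whose end reaches its threshold; by minimality it starts below the preceding
   threshold. *)
pose tau b := (b < B)%N && (mu * X `^ e b.+1 <= (psum N b.+1)%:R).
have ex' : exists b, tau b.
  have [b /andP[bB tb]] := ex; case: b => [|b] in bB tb *; last first.
    by exists b; rewrite /tau bB.
  have mu00 : mu = 0.
    apply/eqP; rewrite eq_le mu0 andbT; move: tb.
    by rewrite psum0 /e expr0 subrr mul0r powRr0 mulr1.
  by exists 0%N; rewrite /tau B0 mu00 mul0r ler0n.
have [b /andP[bB tb] bmin] := ex_minnP ex'.
pose j := Ordinal bB; pose q := X `^ e b.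
have q1 : 1 <= q by rewrite -(powRr0 X) ler_powR.
have Nq : (psum N j)%:R <= mu * q.
  rewrite /j /=; case: (posnP b) => [->|b0]; first by rewrite psum0 mulr_ge0// powR_ge0.
  rewrite leNgt; apply/negP => /ltW Nb.
  have := bmin b.-1; rewrite /tau prednK// Nb (ltnW bB).
  by move=> /(_ isT); rewrite -ltnS prednK// ltnn.
exists j, q; split => //.
- have XE : X `^ e b.+1 = X `^ rate_exponent * q `^ eta.
    by rewrite eS powRD ?XN0 ?implybT// /q -powRrM (mulrC eta).
  (* The exponents e (b + 1) and e b differ by alpha eta^b >= alpha eta^B, so at least half of the
     upper threshold falls within batch [b]. *)
  have Xq : 2 * q <= X `^ e b.+1.
    have -> : X `^ e b.+1 = X `^ (rate_exponent * eta ^+ b) * q.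
      rewrite /q -powRD ?XN0 ?implybT//; congr (_ `^ _).
      by rewrite /e /rate_exponent exprS; field; rewrite gt_eqF.
    rewrite ler_wpM2r ?powR_ge0//; apply: le_trans X2 _.
    rewrite ler_powR// ler_pM2l// ler_wiXn2l ?(ltW eta0) ?(ltW eta1)//.
    exact: ltnW.
  rewrite -(mulrA mu) -XE.
  have -> : (N j)%:R = (psum N b.+1)%:R - (psum N j)%:R :> R.
    by rewrite (psumS N j)/= natrD addrAC subrr add0r.
  have := ler_wpM2l mu0 Xq; move: tb Nq; rewrite /j/=.
  move: (X `^ e _) => Y; move: (_%:R) (_%:R) => u v; lra.
- rewrite /j/=; case: (posnP b) => [->|b0]; first by left.
  right; rewrite ler_powR// ler_pM2r ?invr_gt0// lerD2l lerN2 -[leRHS]expr1.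
  by rewrite ler_wiXn2l// ltW.
Qed.

End CriticalBatch.

(** * Choice of the parameters for the two kernels *)

Lemma natr_ceil {R : realType} (x : R) : 1 <= x ->
  exists2 n : nat, (0 < n)%N & x <= n%:R <= 2 * x.
Proof.
move=> x1; have x0 : 0 <= x by rewrite (le_trans ler01).
have /andP[nx xn] := truncn_itv x0.
exists (Num.truncn x).+1 => //; rewrite ltW//=.
by move: nx; rewrite -(natr1 (Num.truncn x)); lra.
Qed.

Lemma powR_ge_near {R : realType} (gamma : R) : 0 < gamma ->
  exists T0, forall T, (T0 <= T)%N -> 1 <= T%:R :> R /\ 2 <= T%:R `^ gamma.
Proof.
move=> gamma0; have [n _ /andP[n1 _]] := natr_ceil (lexx (1 : R)).
have x1 : 1 <= 2 `^ gamma^-1 :> R by rewrite -[leLHS](powRr0 2) ler_powR ?invr_ge0 ?ltW// ltr1n.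
have [T0 T00 /andP[xT _]] := natr_ceil x1.
exists T0 => T TT0; split; first by rewrite ler1n (leq_trans T00).
apply: (@le_trans _ _ ((2 `^ gamma^-1) `^ gamma)).
  by rewrite -powRrM mulVf ?gt_eqF// powRr1.
apply: ge0_ler_powR; rewrite ?nnegrE ?ler0n ?powR_ge0 ?(ltW gamma0)//.
by rewrite (le_trans xT)// ler_nat.
Qed.

(** Here eta solves d eta / nu = 1 - 2 eta: with h = c q^(- eta) and n of order q^(eta / nu), the
    height is admissible and n^d matches q h^2, of order q^(1 - 2 eta). *)
Lemma matern_lower_bound {R : realType} (d B : nat) (l nu Psi sig : R) :
  (0 < d)%N -> (0 < B)%N -> 0 < l -> 0 < nu -> 0 < Psi -> 0 < sig ->
  batch_lower_bound B (@k_Matern R l nu d) Psi sig (rate_Matern nu d B).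
Proof.
move=> d0 B0 l0 nu0 Psi0 sig0; apply: batch_lower_bound_family => //.
have [C C0 [a a0 family]] := matern_family d l0 nu0 Psi0.
pose eta := eta_Matern nu d.
have dR : 0 < d%:R :> R by rewrite ltr0n.
have den0 : 0 < 2 * nu + d%:R by rewrite addr_gt0// mulr_gt0.
have eta0 : 0 < eta by rewrite divr_gt0.
have eta_half : 2 * eta < 1.
  by rewrite /eta /eta_Matern mulrA ltr_pdivrMr// mul1r ltrDl.
have eta1 : eta < 1 by move: eta_half; lra.
(* 4240 = 8 (2 + 528), once both terms are bounded by multiples of C q^(1 - 2 eta). *)
have [M ME] : exists M, M = 1 + 4240 * C by exists (1 + 4240 * C).
have M1 : 1 <= M by rewrite ME; move: C0; clear; lra.
have M0 : 0 < M by rewrite (lt_le_trans ltr01).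
(* The first bound gives h^2 / sig^2 <= q^(- 2 eta); in the second, the 2 allows for rounding [n]
   up. *)
pose c := Num.min sig (a * (2 * M) `^ (- nu)).
have c0 : 0 < c by rewrite lt_min sig0 mulr_gt0// powR_gt0// mulr_gt0.
have csig : c <= sig by rewrite ge_min lexx.
have ca : c <= a * (2 * M) `^ (- nu) by rewrite ge_min lexx orbT.
have gamma0 : 0 < rate_exponent B eta * eta ^+ B.
  by rewrite mulr_gt0 ?exprn_gt0 ?rate_exponent_gt0.
have [T0 TT0] := powR_ge_near gamma0.
exists (c / 4); first by rewrite divr_gt0.
exists T0 => T /TT0[T1 T2] N sumN.
have NT : 1 * T%:R <= (\sum_(b < B) N b)%:R :> R by rewrite sumN mul1r.
have [j [q [q1 Nq Nj _]]] := critical_batch B0 eta0 eta1 ler01 T1 T2 NT.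
have q0 : 0 < q by rewrite (lt_le_trans ltr01).
have qN0 : q != 0 by rewrite gt_eqF.
have qe1 : 1 <= q `^ (eta / nu).
  by rewrite -[leLHS](powRr0 q) ler_powR// divr_ge0// ltW.
have Mq1 : 1 <= M * q `^ (eta / nu) by rewrite -[leLHS]mul1r ler_pM.
have [n n0 /andP[Mn nM]] := natr_ceil Mq1.
have nR0 : 0 < n%:R :> R by rewrite ltr0n.
exists j, n, (c * q `^ (- eta)), C; split => //.
- apply: family => //; first by rewrite mulr_gt0// powR_gt0.
  apply: (@le_trans _ _ (a * ((2 * M) * q `^ (eta / nu)) `^ (- nu))).
    rewrite powRM ?powR_ge0 ?mulr_ge0 ?(ltW M0)// -powRrM mulrA.
    rewrite (_ : eta / nu * - nu = - eta); last by field; rewrite gt_eqF.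
    by rewrite ler_wpM2r ?powR_ge0.
  rewrite ler_pM2l// !powRN lef_pV2 ?posrE ?powR_gt0 ?mulr_gt0//; first last.
    by rewrite powR_gt0.
  by apply: ge0_ler_powR; rewrite ?nnegrE ?ler0n ?mulr_ge0 ?powR_ge0 ?(ltW nu0) ?(ltW M0)// -mulrA.
- by rewrite mulr_gt0// powR_gt0.
- pose Q := q `^ (1 - 2 * eta).
  have Q1 : 1 <= Q by rewrite -[leLHS](powRr0 q) ler_powR// subr_ge0 ltW.
  apply: (@le_trans _ _ (M * Q)).
    have qQ : q * (q `^ (- eta)) ^+ 2 = Q.
      rewrite -powR_mulrn ?powR_ge0// -powRrM -{1}(powRr1 (ltW q0)) -powRD ?qN0 ?implybT//.
      by congr (_ `^ _); ring.
    have csig2 : c ^+ 2 / sig ^+ 2 <= 1.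
      by rewrite ler_pdivrMr ?exprn_gt0// mul1r !expr2 ler_pM// ltW.
    have pQ : (psum N j)%:R * (c * q `^ (- eta)) ^+ 2 / sig ^+ 2 <= Q.
      rewrite exprMn (_ : _ / _ = (c ^+ 2 / sig ^+ 2) * ((psum N j)%:R * (q `^ (- eta)) ^+ 2));
        last by ring.
      rewrite -[leRHS]mul1r; apply: ler_pM => //.
      - by rewrite divr_ge0 ?sqr_ge0.
      - by rewrite mulr_ge0 ?sqr_ge0.
      - by rewrite -qQ ler_wpM2r ?sqr_ge0// -[leRHS]mul1r.
    rewrite (_ : 528 * C * _ * _ / _ =
      528 * (C * ((psum N j)%:R * (c * q `^ (- eta)) ^+ 2 / sig ^+ 2))); last by ring.
    have := ler_wpM2l (ltW C0) pQ; have := ler_wpM2l (ltW C0) Q1.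
    have -> : M * Q = Q + 4240 * (C * Q) by rewrite ME; ring.
    move: (C * (_ / _)) (C * Q) Q1 => x y; move: (Q) => v; clear; lra.
  apply: (@le_trans _ _ ((M * q `^ (eta / nu)) ^+ d)); last first.
    by rewrite lerXn2r ?nnegrE// mulr_ge0 ?powR_ge0// ltW.
  rewrite exprMn ler_pM ?powR_ge0 ?(ltW M0)//.
    by rewrite -[leLHS]expr1 ler_weXn2l.
  rewrite -powR_mulrn ?powR_ge0// -powRrM /Q.
  by rewrite (_ : eta / nu * _ = 1 - 2 * eta)// /eta /eta_Matern; field; rewrite !gt_eqF.
- rewrite -[rate_Matern _ _ _ _]/(T%:R `^ rate_exponent B eta).
  have := ler_wpM2l (ltW (divr_gt0 c0 (powR_gt0 eta q0))) Nj.
  have qe0 : 0 < q `^ eta by rewrite powR_gt0.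
  rewrite powRN mul1r; set X := _ `^ rate_exponent B eta.
  rewrite (_ : c / _ * (X * _ / 2) = c * X / 2); last first.
    by field; rewrite gt_eqF.
  by move: (c / q `^ eta) (X) => u Y; clear; lra.
Qed.

Lemma rate_SE_E {R : realType} (d B T : nat) (s : R) : (0 < B)%N -> 0 < s ->
  ln T%:R = s ^+ 2 -> (0 < T)%N ->
  rate_SE R d B T =
  s ^+ d * (T%:R / s ^+ d) `^ rate_exponent B (eta_SE R).
Proof.
move=> B0 s0 sE T0; rewrite /rate_SE sE; set eta := eta_SE R.
have etaB : 1 - eta ^+ B != 0.
  rewrite gt_eqF// subr_gt0 exprn_ilt1 -?lt0n// /eta /eta_SE; lra.
have sd0 : 0 < s ^+ d by rewrite exprn_gt0.
rewrite [in RHS]powRM ?invr_ge0 ?ler0n ?ltW// [RHS]mulrCA; congr (_ * _).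
have sN0 : s != 0 by rewrite gt_eqF.
rewrite -(powR_inv1 (ltW sd0)) -!(powR_mulrn _ (ltW s0)).
rewrite -!powRrM -powRD ?sN0 ?implybT//; congr (_ `^ _).
by rewrite /rate_exponent; field.
Qed.

Lemma ln_ge_near {R : realType} (S : R) : 0 <= S ->
  exists T0, forall T, (T0 <= T)%N -> (0 < T)%N /\ S <= Num.sqrt (ln T%:R).
Proof.
move=> S0; have e1 : 1 <= expR (S ^+ 2) by rewrite -expR0 ler_expR sqr_ge0.
have [T0 T00 /andP[ST _]] := natr_ceil e1; exists T0 => T TT0.
have T1 : (0 < T)%N by rewrite (leq_trans T00).
split=> //; rewrite -[leLHS](ger0_norm S0) -sqrtr_sqr ler_wsqrtr//.
by rewrite -ler_expR lnK ?posrE ?ltr0n// (le_trans ST)// ler_nat.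
Qed.

(** With n of order s, the number of bumps is of order mu for every [q], and eta = 1/2 keeps q h^2
    constant. A batch with a past has q >= X^alpha, so its height is below a negative power of T and
    small [delta] makes it admissible. A batch without observations needs only a fixed number
    [n0]. *)
Lemma se_lower_bound {R : realType} (d B : nat) (l Psi sig : R) :
  (0 < d)%N -> (0 < B)%N -> 0 < l -> 0 < Psi -> 0 < sig ->
  batch_lower_bound B (@k_SE R l d) Psi sig (rate_SE R d B).
Proof.
move=> d0 B0 l0 Psi0 sig0; apply: batch_lower_bound_family => //.
have [C C0 [a a0 [K K0 family]]] := gaussian_family d l0 Psi0.
pose eta := eta_SE R.
have eta0 : 0 < eta by rewrite /eta /eta_SE; lra.
have eta1 : eta < 1 by rewrite /eta /eta_SE; lra.
pose alpha := rate_exponent B eta.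
have alpha0 : 0 < alpha by exact: rate_exponent_gt0.
have gamma0 : 0 < alpha * eta ^+ B by rewrite mulr_gt0 ?exprn_gt0.
(* From n <= 2 delta s one gets K n^2 <= alpha s^2 / 4, while q^(1/2) >= X^(alpha / 2) >= e^(alpha
   s^2 / 4). *)
pose delta := Num.min 1 (alpha / (16 * K)).
have delta0 : 0 < delta by rewrite lt_min ltr01 divr_gt0// mulr_gt0.
have delta1 : delta <= 1 by rewrite ge_min lexx.
have deltaK : 16 * K * delta ^+ 2 <= alpha.
  rewrite -ler_pdivlMl ?mulr_gt0// mulrC expr2.
  apply: le_trans (ler_wpM2r (ltW delta0) delta1) _.
  by rewrite mul1r ge_min lexx orbT.
have deltad : 0 < delta ^+ d by rewrite exprn_gt0.
have [n0 n00 /andP[n0C _]] := natr_ceil (ltac:(lra) : 1 <= 1 + 16 * C).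
(* 8448 = 16 * 528: with [r] below, the energy term takes half of delta^d mu and leaves the other
   half to 16 C. *)
have [b b0 bE] : exists2 b : R, 0 < b & forall x, x * b = 16 * (528 * x).
  by exists 8448 => [|x]; [rewrite ltr0n|ring].
pose r := delta ^+ d * sig ^+ 2 / (b * C).
have r0 : 0 < r by rewrite divr_gt0 ?mulr_gt0 ?exprn_gt0.
pose c := Num.min (Num.min a (a * expR (- (K * n0%:R ^+ 2)))) (Num.sqrt r).
have c0 : 0 < c by rewrite !lt_min a0 sqrtr_gt0 r0 mulr_gt0 ?expR_gt0.
have ca : c <= a by rewrite !ge_min lexx.
have ca0 : c <= a * expR (- (K * n0%:R ^+ 2)) by rewrite !ge_min lexx ?orbT.
have cr : c ^+ 2 <= r.
  rewrite -(sqr_sqrtr (ltW r0)) !expr2.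
  by rewrite ler_pM ?(ltW c0)// ge_min lexx orbT.
(* After 1, the lower bounds on s ensure in turn that mu <= sqrt T, delta s >= 1, 32 C <= delta^d mu
   and X^(alpha eta^B) >= 2. *)
pose S := Num.max 1 (Num.max (2 * d%:R) (Num.max delta^-1
  (Num.max (32 * C / delta ^+ d) (2 / (alpha * eta ^+ B))))).
have S1 : [/\ 1 <= S, 2 * d%:R <= S, delta^-1 <= S, 32 * C / delta ^+ d <= S
  & 2 / (alpha * eta ^+ B) <= S] by rewrite !le_max !lexx ?orbT.
have S0 : 0 <= S by case: S1 => + _ _ _ _; exact: le_trans.
have [T0 TT0] := ln_ge_near S0.
exists (c / 4); first by rewrite divr_gt0.
exists T0 => T /TT0[Tpos Ss] N sumN.
pose s := Num.sqrt (ln T%:R : R).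
have s_ge x : x <= S -> x <= s by move=> /le_trans; exact.
have [/s_ge s1 /s_ge sd /s_ge sdelta /s_ge sC /s_ge sgamma] := S1.
have s0 : 0 < s by rewrite (lt_le_trans ltr01).
have TR : 0 < T%:R :> R by rewrite ltr0n.
have sE : ln T%:R = s ^+ 2 by rewrite sqr_sqrtr// ln_ge0// ler1n.
have TE : T%:R = expR (s ^+ 2 / 2) * expR (s ^+ 2 / 2).
  by rewrite -expRD -splitr -sE lnK.
pose mu := s ^+ d; pose X := T%:R / mu.
have mu0 : 0 < mu by rewrite exprn_gt0.
have mu_le : mu <= expR (s ^+ 2 / 2).
  apply: (@le_trans _ _ (expR s ^+ d)).
    rewrite lerXn2r ?nnegrE ?expR_ge0 ?(ltW s0)//.
    by apply: le_trans (expR_ge1Dx _); rewrite lerDr.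
  rewrite -expRM_natl ler_expR expr2.
  by rewrite ler_pdivlMr// mulrC mulrA ler_wpM2r// ltW.
have X_ge : expR (s ^+ 2 / 2) <= X.
  by rewrite ler_pdivlMr// TE ler_pM2l ?expR_gt0.
have X0 : 0 < X by rewrite divr_gt0.
have Xpow x : 0 <= x -> expR (s ^+ 2 / 2 * x) <= X `^ x.
  move=> x0; rewrite expRM; apply: ge0_ler_powR => //.
    by rewrite nnegrE expR_ge0.
  by rewrite nnegrE ltW.
have X1 : 1 <= X.
  apply: le_trans X_ge; rewrite -expR0 ler_expR.
  by rewrite divr_ge0 ?sqr_ge0.
have s_sqr : s <= s ^+ 2 by rewrite expr2 ler_peMr// ltW.
have X2 : 2 <= X `^ (alpha * eta ^+ B).
  apply: le_trans (Xpow _ (ltW gamma0)).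
  apply: le_trans (expR_ge1Dx _); rewrite (_ : 2 = 1 + 1)// lerD2l.
  rewrite mulrAC ler_pdivlMr// mul1r -ler_pdivrMr//.
  exact: le_trans s_sqr.
have NX : mu * X <= (\sum_(b < B) N b)%:R.
  by rewrite sumN /X mulrC divfK// gt_eqF.
have [j [q [q1 Nq Nj case_q]]] :=
  critical_batch B0 eta0 eta1 (ltW mu0) X1 X2 NX.
have q0 : 0 < q by rewrite (lt_le_trans ltr01).
have rateE := rate_SE_E d B0 s0 sE Tpos.
case: case_q => [Nj0|qX].
  exists j, n0, c, C; split => //; first exact: family.
  - rewrite Nj0 mulr0 !mul0r addr0 (le_trans _ (ler_eXnr d0 _)) //.
      by move: n0C; clear; lra.
    by rewrite ler1n.
  - rewrite rateE -/mu -/X -/eta -/alpha.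
    have qe : 1 <= q `^ eta by rewrite -[leLHS](powRr0 q) ler_powR// ltW.
    have Y0 : 0 <= mu * X `^ alpha by rewrite mulr_ge0 ?powR_ge0// ltW.
    have half_ge0 : 0 <= 2^-1 :> R by rewrite invr_ge0.
    have := ler_wpM2l (ltW c0)
      (le_trans (ler_wpM2r half_ge0 (ler_wpM2l Y0 qe)) Nj).
    rewrite mulr1; move: (mu * _) => Y; clear; lra.
have ds1 : 1 <= delta * s by rewrite mulrC -ler_pdivrMr// mul1r.
have [n npos /andP[dsn nds]] := natr_ceil ds1.
have qE : (q `^ (- eta)) ^+ 2 = q^-1.
  rewrite -powR_mulrn ?powR_ge0// -powRrM -powR_inv1 ?(ltW q0)//.
  by congr (_ `^ _); rewrite /eta /eta_SE; field.
exists j, n, (c * q `^ (- eta)), C; split => //.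
- apply: family => //; first by rewrite mulr_gt0// powR_gt0.
  apply: ler_pM => //; [exact: ltW|exact: powR_ge0|].
  apply: (@le_trans _ _ (expR (- (s ^+ 2 / 2 * alpha * eta)))).
    rewrite powRN expRN lef_pV2 ?posrE ?expR_gt0 ?powR_gt0//.
    rewrite expRM; apply: ge0_ler_powR; rewrite ?nnegrE ?expR_ge0 ?(ltW q0) ?(ltW eta0)//.
    exact: le_trans (Xpow _ (ltW alpha0)) qX.
  rewrite ler_expR lerN2.
  apply: (@le_trans _ _ (K * (2 * (delta * s)) ^+ 2)).
    by rewrite ler_pM2l// !expr2 ler_pM.
  have := ler_wpM2r (sqr_ge0 s) deltaK.
  rewrite (_ : 16 * K * _ * _ = 16 * (K * delta ^+ 2 * s ^+ 2)); last by ring.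
  rewrite (_ : K * (2 * _) ^+ 2 = 4 * (K * delta ^+ 2 * s ^+ 2)); last by ring.
  rewrite (_ : _ * eta = alpha * s ^+ 2 / 4); last by rewrite /eta /eta_SE; field.
  move: (K * _ * _) (alpha * s ^+ 2) => x y; clear; lra.
- by rewrite mulr_gt0// powR_gt0.
- apply: (@le_trans _ _ (delta ^+ d * mu)); last first.
    by rewrite -exprMn lerXn2r ?nnegrE// mulr_ge0 ?(ltW delta0) ?(ltW s0).
  have Cmu : 32 * C <= delta ^+ d * mu.
    rewrite [leRHS]mulrC -ler_pdivrMr//; apply: le_trans sC _.
    by rewrite ler_eXnr.
  have qmu : (psum N j)%:R * (c * q `^ (- eta)) ^+ 2 / sig ^+ 2 <= mu * (r / sig ^+ 2).
    rewrite [leRHS]mulrA ler_wpM2r ?invr_ge0 ?sqr_ge0// exprMn qE.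
    apply: (@le_trans _ _ (mu * q * (c ^+ 2 / q))).
      by rewrite ler_wpM2r// divr_ge0 ?sqr_ge0// ltW.
    rewrite (_ : mu * q * _ = mu * c ^+ 2); last by field; rewrite gt_eqF.
    by rewrite ler_pM2l.
  have rE : C * (mu * (r / sig ^+ 2)) = delta ^+ d * mu / b.
    by rewrite /r; field; rewrite !gt_eqF.
  have := ler_wpM2l (ltW C0) qmu; rewrite rE ler_pdivlMr// bE.
  rewrite (_ : 528 * C * _ * _ / _ =
    528 * (C * ((psum N j)%:R * (c * q `^ (- eta)) ^+ 2 / sig ^+ 2))); last by ring.
  move: (C * (_ / _)) (delta ^+ d * mu) Cmu => x y; clear; lra.
- rewrite rateE -/mu -/X -/eta -/alpha.
  have qe0 : 0 < q `^ eta by rewrite powR_gt0.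
  have := ler_wpM2l (ltW (divr_gt0 c0 qe0)) Nj.
  rewrite powRN.
  rewrite (_ : c / _ * (_ * _ / 2) = c * (mu * X `^ alpha) / 2); last first.
    by field; rewrite gt_eqF.
  move: (c / q `^ eta) (mu * _) => u Y; clear; lra.
Qed.

Theorem theorem3 (R : realType) (d B : nat) (l nu Psi sig : R) :
  (0 < d)%N -> (0 < B)%N -> 0 < l -> 0 < nu -> 0 < Psi -> 0 < sig ->
  batch_lower_bound B (@k_SE R l d) Psi sig (rate_SE R d B) /\
  batch_lower_bound B (@k_Matern R l nu d) Psi sig (rate_Matern nu d B).
Proof.
move=> d0 B0 l0 nu0 Psi0 sig0.
by split; [exact: se_lower_bound|exact: matern_lower_bound].
Qed.
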